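(* The satisfiability problem for $\mathrm{GRA}(e,p,s,I,\neg,J)$ is $\textsc{NP}$-complete.
   Context: AD-relations. $A^0=\{\epsilon\}$, with $\epsilon$ the empty tuple. A $k$-ary AD-relation over a set $A$ is a pair $(R,k)$ with $R\subseteq A^k$, $k\ge 0$; $t\in(R,k)$ means $t\in R$. Vocabularies contain only relation symbols (of any arity $k\ge 0$, countably infinitely many available for each arity). Models have nonempty domains; $A$ is the domain of $\mathfrak{A}$. Terms. $\mathrm{GRA}(e,p,s,I,\neg,J)$ is the set of terms built from relation symbols and the constant $e$ by the unary operators $p,s,I,\neg$ and the binary operator $J$. Each term $\mathcal{T}$ defines in each model $\mathfrak{A}$ an AD-relation $\mathcal{T}^{\mathfrak{A}}$ of arity $\mathit{ar}(\mathcal{T})$. Let $k=\mathit{ar}(\mathcal{T})$, $\ell=\mathit{ar}(\mathcal{S})$. - $R^{\mathfrak{A}}$ is the interpretation of $R$, paired with the arity of $R$; $e^{\mathfrak{A}}=(\{(a,a)\mid a\in A\},2)$. - If $k\ge2$: $(p\mathcal{T})^{\mathfrak{A}}=(\{(a_k,a_1,\dots,a_{k-1})\mid(a_1,\dots,a_k)\in\mathcal{T}^{\mathfrak{A}}\},k)$; $(s\mathcal{T})^{\mathfrak{A}}=(\{(a_1,\dots,a_{k-2},a_k,a_{k-1})\mid(a_1,\dots,a_k)\in\mathcal{T}^{\mathfrak{A}}\},k)$; $(I\mathcal{T})^{\mathfrak{A}}=(\{(a_1,\dots,a_{k-1})\mid(a_1,\dots,a_k)\in\mathcal{T}^{\mathfrak{A}},\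 a_{k-1}=a_k\},k-1)$. If $k\le1$, each of $p\mathcal{T},s\mathcal{T},I\mathcal{T}$ is interpreted as $\mathcal{T}^{\mathfrak{A}}$. - $(\neg\mathcal{T})^{\mathfrak{A}}=(\{t\in A^k\mid t\notin\mathcal{T}^{\mathfrak{A}}\},k)$. - $(J(\mathcal{T},\mathcal{S}))^{\mathfrak{A}}=(\{(a_1,\dots,a_k,b_1,\dots,b_\ell)\mid(a_1,\dots,a_k)\in\mathcal{T}^{\mathfrak{A}},(b_1,\dots,b_\ell)\in\mathcal{S}^{\mathfrak{A}}\},k+\ell)$. Satisfiability problem for a set $\mathcal{G}$ of terms: on input $\mathcal{T}\in\mathcal{G}$, answer yes iff there exists a model $\mathfrak{A}$ such that $\mathcal{T}^{\mathfrak{A}}$ is not the empty AD-relation $(\varnothing,\mathit{ar}(\mathcal{T}))$. *)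

(* Defs.v *)
From HB Require Import structures.
From mathcomp Require Import all_boot.

Set Implicit Arguments.
Unset Strict Implicit.
Unset Printing Implicit Defensive.

(** * Deterministic multitape Turing machines *)

(** A cell holds [None] (blank) or a letter of the tape alphabet [G].  A tape is
    infinite in both directions: [tape_left] lists the cells to the left of the
    head, nearest first, [tape_right] those to its right, and every cell that is
    not listed is blank. *)
Record tape (G : Type) := Tape {
  tape_left : seq (option G);
  tape_head : option G;
  tape_right : seq (option G)
}.

Inductive move := MoveLeft | MoveStay | MoveRight.

Definition tape_of (G : Type) (w : seq G) : tape G :=
  if w is a :: v then Tape [::] (Some a) (map Some v)
  else Tape [::] None [::].

Definition tape_write (G : Type) (a : option G) (t : tape G) : tape G :=
  Tape (tape_left t) a (tape_right t).

Definition tape_move (G : Type) (m : move) (t : tape G) : tape G :=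
  let: Tape l a r := t in
  match m with
  | MoveLeft => if l is b :: l' then Tape l' b (a :: r)
                else Tape [::] None (a :: r)
  | MoveStay => t
  | MoveRight => if r is b :: r' then Tape (a :: l) b r'
                 else Tape (a :: l) None [::]
  end.

(** The word that starts under the head and extends to the first blank. *)
Definition tape_word (G : eqType) (t : tape G) : seq G :=
  let cells := tape_head t :: tape_right t in
  pmap id (take (index None cells) cells).

(** [tm_tapes.+1] tapes; tape [ord0] is both the input and the output tape.
    The machine halts when [tm_delta] returns [None]. *)
Record tm := TM {
  tm_tapes : nat;
  tm_alphabet : finType;
  tm_state : finType;
  tm_start : tm_state;
  tm_accept : pred tm_state;
  tm_delta : tm_state -> {ffun 'I_tm_tapes.+1 -> option tm_alphabet} ->
    option (tm_state * {ffun 'I_tm_tapes.+1 -> option tm_alphabet * move})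
}.

Record config (M : tm) := Config {
  conf_state : tm_state M;
  conf_tapes : {ffun 'I_(tm_tapes M).+1 -> tape (tm_alphabet M)}
}.

Definition init (M : tm) (w : seq (tm_alphabet M)) : config M :=
  Config (tm_start M) [ffun i => if i == ord0 then tape_of w else tape_of [::]].

Definition step (M : tm) (c : config M) : option (config M) :=
  let: Config q ts := c in
  if tm_delta q [ffun i => tape_head (ts i)] is Some (q', act) then
    Some (Config q' [ffun i => tape_move (act i).2 (tape_write (act i).1 (ts i))])
  else None.

(** A halted configuration is left unchanged by [run]. *)
Definition run (M : tm) (n : nat) (c : config M) : config M :=
  iter n (fun c => odflt c (step c)) c.

Definition halted (M : tm) (c : config M) : Prop := step c = None.

(** * Polynomial time and NP *)

Definition poly_bound (c d n : nat) : nat := c * n ^ d + c.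

(** Input and output alphabets are regarded as subsets of the tape alphabet by
    means of the injections [i] and [o]. *)
Definition polytime_decidable (S : finType) (L : seq S -> Prop) : Prop :=
  exists (M : tm) (i : S -> tm_alphabet M) (c d : nat),
    injective i /\
    forall w : seq S,
      let final := run (poly_bound c d (size w)) (init (map i w)) in
      halted final /\ (tm_accept (conf_state final) <-> L w).

Definition polytime_computable (S S' : finType) (f : seq S -> seq S') : Prop :=
  exists (M : tm) (i : S -> tm_alphabet M) (o : S' -> tm_alphabet M) (c d : nat),
    injective i /\ injective o /\
    forall w : seq S,
      let final := run (poly_bound c d (size w)) (init (map i w)) in
      halted final /\ tape_word (conf_tapes final ord0) = map o (f w).

(** Certificates are bit strings.  Input letters and certificate bits are
    distinct letters of [S + bool], so the concatenation encodes the pair. *)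
Definition in_NP (S : finType) (L : seq S -> Prop) : Prop :=
  exists (V : seq (S + bool) -> Prop) (c d : nat),
    polytime_decidable V /\
    forall w : seq S,
      L w <-> exists2 u : seq bool,
                size u <= poly_bound c d (size w) & V (map inl w ++ map inr u).

Definition poly_reducible (S S' : finType)
    (L : seq S -> Prop) (L' : seq S' -> Prop) : Prop :=
  exists f : seq S -> seq S',
    polytime_computable f /\ forall w : seq S, L w <-> L' (f w).

Definition NP_hard (S : finType) (L : seq S -> Prop) : Prop :=
  forall (S0 : finType) (L0 : seq S0 -> Prop), in_NP L0 -> poly_reducible L0 L.

Definition NP_complete (S : finType) (L : seq S -> Prop) : Prop :=
  in_NP L /\ NP_hard L.

(** * AD-relations *)

Definition adrel (A : Type) : Type := {k : nat & k.-tuple A -> Prop}.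

Definition arity (A : Type) (r : adrel A) : nat := tag r.

Definition ad_mem (A : Type) (r : adrel A) (x : seq A) : Prop :=
  exists2 t : (arity r).-tuple A, tval t = x & tagged r t.

Definition ad_set (A : Type) (k : nat) (P : seq A -> Prop) : adrel A :=
  existT (fun k => k.-tuple A -> Prop) k (fun t => P (tval t)).

Definition ad_e (A : Type) : adrel A :=
  ad_set 2 (fun x => exists a, x = [:: a; a]).

Definition ad_p (A : Type) (r : adrel A) : adrel A :=
  if 2 <= arity r then
    ad_set (arity r) (fun x => exists (v : seq A) (a : A),
      x = a :: v /\ ad_mem r (rcons v a))
  else r.

Definition ad_s (A : Type) (r : adrel A) : adrel A :=
  if 2 <= arity r then
    ad_set (arity r) (fun x => exists (v : seq A) (a b : A),
      x = v ++ [:: b; a] /\ ad_mem r (v ++ [:: a; b]))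
  else r.

Definition ad_I (A : Type) (r : adrel A) : adrel A :=
  if 2 <= arity r then
    ad_set (arity r).-1 (fun x => exists (v : seq A) (a : A),
      x = rcons v a /\ ad_mem r (v ++ [:: a; a]))
  else r.

Definition ad_neg (A : Type) (r : adrel A) : adrel A :=
  ad_set (arity r) (fun x => ~ ad_mem r x).

Definition ad_J (A : Type) (r q : adrel A) : adrel A :=
  ad_set (arity r + arity q) (fun x => exists u v : seq A,
    [/\ x = u ++ v, ad_mem r u & ad_mem q v]).

(** * Terms *)

(** [Rel k x] is the relation symbol of arity [k] whose name is the bit string
    [x]; thus there are countably infinitely many symbols of each arity. *)
Inductive term :=
| Rel of nat & seq bool
| TermE
| TermP of term
| TermS of term
| TermI of term
| TermNeg of term
| TermJ of term & term.

(** A model interprets every relation symbol. *)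
Record model := Model {
  dom : Type;
  dom_inhabited : inhabited dom;
  rel_interp : forall (k : nat) (x : seq bool), k.-tuple dom -> Prop
}.

Fixpoint interp (A : model) (T : term) : adrel (dom A) :=
  match T with
  | Rel k x => existT (fun k => k.-tuple (dom A) -> Prop) k (@rel_interp A k x)
  | TermE => ad_e (dom A)
  | TermP T1 => ad_p (interp A T1)
  | TermS T1 => ad_s (interp A T1)
  | TermI T1 => ad_I (interp A T1)
  | TermNeg T1 => ad_neg (interp A T1)
  | TermJ T1 T2 => ad_J (interp A T1) (interp A T2)
  end.

Definition satisfiable (T : term) : Prop :=
  exists (A : model) (x : seq (dom A)), ad_mem (interp A T) x.

(** * The satisfiability problem as a formal language *)

Inductive letter :=
| LRel | LTick | LBit of bool | LE | LP | LS | LI | LNeg | LJ.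

Definition letter_code (a : letter) : bool + 'I_8 :=
  match a with
  | LBit b => inl b
  | LRel => inr (@Ordinal 8 0 isT) | LTick => inr (@Ordinal 8 1 isT)
  | LE => inr (@Ordinal 8 2 isT) | LP => inr (@Ordinal 8 3 isT) | LS => inr (@Ordinal 8 4 isT)
  | LI => inr (@Ordinal 8 5 isT) | LNeg => inr (@Ordinal 8 6 isT) | LJ => inr (@Ordinal 8 7 isT)
  end.

Definition letter_decode (c : bool + 'I_8) : letter :=
  match c with
  | inl b => LBit b
  | inr i => nth LRel [:: LRel; LTick; LE; LP; LS; LI; LNeg; LJ] i
  end.

Lemma letter_codeK : cancel letter_code letter_decode.
Proof. by case. Qed.

HB.instance Definition _ := Finite.copy letter (can_type letter_codeK).

(** Polish notation.  A relation symbol is written with its arity in unary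
    followed by its name. *)
Fixpoint encode (T : term) : seq letter :=
  match T with
  | Rel k x => LRel :: nseq k LTick ++ map LBit x
  | TermE => [:: LE]
  | TermP T1 => LP :: encode T1
  | TermS T1 => LS :: encode T1
  | TermI T1 => LI :: encode T1
  | TermNeg T1 => LNeg :: encode T1
  | TermJ T1 T2 => LJ :: encode T1 ++ encode T2
  end.

Definition GRA_sat (w : seq letter) : Prop :=
  exists2 T : term, w = encode T & satisfiable T.

(* Main.v *)
(** Each subterm of a term, evaluated at a fixed tuple, only needs the value of
    its own subterms at one tuple each: [p], [s], [I] and [neg] act on one tuple,
    and [J] splits it.  A term is therefore satisfiable iff one can assign a tuple
    and a truth value to every leaf so that propagating them from the leaves to
    the root never meets an [I] with distinct last entries, two leaves with the
    same symbol and tuple get the same value, and the root gets the value true.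
    Only the equality pattern of the entries matters, so such an assignment is a
    certificate of polynomial size.

    Conversely, relation symbols of arity 0 with [neg] and [J] form propositional
    logic, so hardness is the Cook-Levin theorem for multitape machines.  Tape
    cells are addressed relative to the head: a transition then shifts the whole
    tape, by an amount that the current state and the letters under the heads
    determine, and no head positions have to be encoded.

    Both the checker and the reduction are written for a stack machine whose only
    loop repeats its body once per input letter, hence runs in polynomial time. *)

Require Import Defs.
From HB Require Import structures.
From Stdlib Require Import Classical ClassicalEpsilon.
From mathcomp Require Import all_boot zify.

Set Implicit Arguments.
Unset Strict Implicit.
Unset Printing Implicit Defensive.


(** * Polynomial bounds *)

(** Descending evaluation would have to know the arity of an argument of [J] before splitting the
    tuple; going upwards, the arity is the length of the tuple in hand, and reading Polish notation
    from right to left turns the check into evaluation with a stack. Tuples are stacked in reverse,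
    because [s] and [I] act on the last two entries. No operator projects elements away, so the
    entries of the tuple at the root are the only elements that a certificate has to name.

    A program cannot leave a loop early. This makes the time bound automatic: it is proved once, by
    induction on commands. The price is that a body must idle when its work is done and that the
    contents of registers must be shown to stay within the number of rounds.

    In the tableau, cells shift with the head, so there are no fixed boundary cells. The window of
    cells that the formulas control is allowed to shrink by one per step, and it starts out wider
    than the running time. *)

Definition polyb (f : nat -> nat) : Prop :=
  exists c k, forall n, f n <= c * n.+1 ^ k.

(** The base [n.+1] in [polyb] is positive, so powers grow with the exponent even at [n = 0], and
    bounds of different degrees can be added. *)
Lemma leq_expS n a b : a <= b -> n.+1 ^ a <= n.+1 ^ b.
Proof. exact: leq_pexp2l. Qed.

Lemma leq_expl m n k : m <= n -> m ^ k <= n ^ k.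
Proof. by case: k => // k; rewrite leq_exp2r. Qed.

Lemma polyb_le f g : (forall n, f n <= g n) -> polyb g -> polyb f.
Proof.
by move=> fg [c [k gP]]; exists c, k => n; apply: leq_trans (fg n) (gP n).
Qed.

Lemma polyb_const c : polyb (fun=> c).
Proof. by exists c, 0 => n; rewrite expn0 muln1. Qed.

Lemma polyb_id : polyb id.
Proof. by exists 1, 1 => n; rewrite expn1 mul1n. Qed.

Lemma polyb_add f g : polyb f -> polyb g -> polyb (fun n => f n + g n).
Proof.
move=> [c [k fP]] [c' [k' gP]]; exists (c + c'), (k + k') => n.
rewrite mulnDl leq_add //.
  by apply: leq_trans (fP n) _; rewrite leq_mul2l leq_expS ?orbT ?leq_addr.
by apply: leq_trans (gP n) _; rewrite leq_mul2l leq_expS ?orbT ?leq_addl.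
Qed.

Lemma polyb_mul f g : polyb f -> polyb g -> polyb (fun n => f n * g n).
Proof.
move=> [c [k fP]] [c' [k' gP]]; exists (c * c'), (k + k') => n.
by rewrite expnD mulnACA leq_mul.
Qed.

Lemma polyb_exp f k : polyb f -> polyb (fun n => f n ^ k).
Proof.
move=> fP; elim: k => [|k IH]; first exact: polyb_const.
by apply: polyb_le (polyb_mul fP IH) => n; rewrite expnS.
Qed.

Lemma polyb_poly_bound c d f : polyb f -> polyb (fun n => poly_bound c d (f n)).
Proof.
move=> fP; apply: polyb_add (polyb_const c).
by apply: polyb_mul (polyb_const c) (polyb_exp d fP).
Qed.

(** For positive [n], [n.+1 <= 2 * n] costs the factor [2 ^ k]; at 0 the additive constant of
    [poly_bound] suffices. *)
Lemma polybP f : polyb f -> exists c d, forall n, f n <= poly_bound c d n.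
Proof.
move=> [c [k fP]]; exists (c * 2 ^ k), k => -[|n]; apply: leq_trans (fP _) _.
  by rewrite exp1n muln1 /poly_bound -[X in X <= _]muln1 (leq_trans _ (leq_addl _ _)) // leq_mul2l expn_gt0 orbT.
rewrite /poly_bound -mulnA -expnMn (leq_trans _ (leq_addr _ _)) //.
by rewrite leq_mul2l leq_expl ?orbT //; lia.
Qed.

Lemma leq_poly_bound c d m n : m <= n -> poly_bound c d m <= poly_bound c d n.
Proof. by move=> mn; rewrite leq_add2r leq_mul2l leq_expl ?orbT. Qed.

(** * Stack programs *)

Section StackPrograms.
Context (A : finType).

(* [Loop c] runs [c] as many times as the input has letters; every other
   command takes bounded time, so all programs run in polynomial time. *)
Inductive cmd :=
| Skip
| Push of nat & A
| Pop of nat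
| Seq of cmd & cmd
| Case of nat & (option A -> cmd)
| Loop of cmd.

Definition store := seq (seq A).

Definition get (s : store) r : seq A := nth [::] s r.
Definition upd (s : store) r v : store := set_nth [::] s r v.

Fixpoint den n c s : store :=
  match c with
  | Skip => s
  | Push r a => upd s r (a :: get s r)
  | Pop r => upd s r (behead (get s r))
  | Seq c1 c2 => den n c2 (den n c1 s)
  | Case r f => den n (f (ohead (get s r))) s
  | Loop c => iter n (den n c) s
  end.

(** Bounds the time of the compiled machine. Besides its body, a loop spends five steps on each
    clock letter, one for the test and four for the move, and five more when the clock is refilled;
    the failing tests that end these two passes make up the 2. *)
Fixpoint cost n c : nat :=
  match c with
  | Skip => 1
  | Push _ _ => 2
  | Pop _ => 1
  | Seq c1 c2 => cost n c1 + cost n c2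
  | Case r f => (\max_a cost n (f a)).+1
  | Loop c => n * (cost n c + 10) + 2
  end.

Fixpoint depth c : nat :=
  match c with
  | Seq c1 c2 => maxn (depth c1) (depth c2)
  | Case r f => \max_a depth (f a)
  | Loop c => (depth c).+1
  | _ => 0
  end.

Fixpoint width c : nat :=
  match c with
  | Skip => 0
  | Push r _ | Pop r => r.+1
  | Seq c1 c2 => maxn (width c1) (width c2)
  | Case r f => maxn r.+1 (\max_a width (f a))
  | Loop c => width c
  end.

Lemma polyb_cost c : polyb (fun n => cost n c).
Proof.
elim: c => /= [|_ _|_|c1 IH1 c2 IH2|r f IH|c IH].
- exact: polyb_const.
- exact: polyb_const.
- exact: polyb_const.
- exact: polyb_add.
(* A maximum over finitely many letters is bounded by the sum, to which closure under addition
   applies. *)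
- suff: polyb (fun n => (\sum_(a <- enum {: option A}) cost n (f a)) + 1).
    apply: polyb_le => n; rewrite addn1 ltnS; apply/bigmax_leqP => a _.
    by rewrite (big_rem a) ?mem_enum //= leq_addr.
  apply: polyb_add (polyb_const 1).
  elim: (enum _) => [|a l IHl].
    by apply: polyb_le (polyb_const 0) => n; rewrite big_nil.
  by apply: polyb_le (polyb_add (IH a) IHl) => n; rewrite big_cons.
- apply: polyb_add (polyb_const 2); apply: polyb_mul polyb_id _.
  by apply: polyb_add IH (polyb_const 10).
Qed.

(** * Machine fragments *)

Context (K : nat).
Notation heads := {ffun 'I_K.+1 -> option A}.
Notation act := {ffun 'I_K.+1 -> option A * move}.
Notation tapes := {ffun 'I_K.+1 -> tape A}.

Record frag := Frag {
  fstate : finType;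
  fstart : fstate;
  fdelta : fstate -> heads -> option fstate * act
}.

Definition heads_of (ts : tapes) : heads := [ffun i => tape_head (ts i)].
Definition perform (a : act) (ts : tapes) : tapes :=
  [ffun i => tape_move (a i).2 (tape_write (a i).1 (ts i))].

(* The state [None] is the exit of the fragment. *)
Inductive frun (f : frag) : nat -> option (fstate f) -> tapes -> tapes -> Prop :=
| FDone ts : frun 0 None ts ts
| FStep q ts t ts' :
    frun t (fdelta q (heads_of ts)).1 (perform (fdelta q (heads_of ts)).2 ts) ts' ->
    frun t.+1 (Some q) ts ts'.

(** The common core of all compositions: a run of [f] is replayed inside [g], with the exit of [f]
    redirected to [e]. *)
Lemma frun_embed (f g : frag) (phi : fstate f -> fstate g) (e : option (fstate g)) :
  (forall q h, fdelta (phi q) h =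
     (if (fdelta q h).1 is Some q' then Some (phi q') else e, (fdelta q h).2)) ->
  forall t oq ts ts1, @frun f t oq ts ts1 ->
  forall t' ts2, frun t' e ts1 ts2 ->
  frun (t + t') (if oq is Some q then Some (phi q) else e) ts ts2.
Proof.
move=> phiP t oq ts ts1; elim=> {t oq ts ts1} // q ts t ts' _ IH t' ts2 run2.
by rewrite addSn; apply: FStep; rewrite phiP /=; apply: IH.
Qed.

Definition tape_rep (s : seq A) (T : tape A) : Prop :=
  exists m, tape_head T :: tape_right T = map Some s ++ nseq m None.

Definition rep (s : nat -> seq A) (ts : tapes) : Prop :=
  forall i : 'I_K.+1, tape_rep (s i) (ts i).

Definition reach (f : frag) (s : nat -> seq A) (t : nat) (s' : nat -> seq A) : Prop :=
  forall ts, rep s ts -> exists2 ts', frun t (Some (fstart f)) ts ts' & rep s' ts'.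

Lemma eq_reach f s1 s2 t s1' s2' :
  s1 =1 s2 -> s1' =1 s2' -> reach f s1 t s1' -> reach f s2 t s2'.
Proof.
move=> e e' R ts tsP; have [|ts' run tsP'] := R ts.
  by move=> i; rewrite e.
by exists ts' => // i; rewrite -e'.
Qed.

Definition fupd (s : nat -> seq A) r v : nat -> seq A :=
  fun i => if i == r then v else s i.

Definition idle (h : heads) : act := [ffun i => (h i, MoveStay)].
Definition act_at r (h : heads) (a : option A * move) : act :=
  [ffun i : 'I_K.+1 => if val i == r then a else (h i, MoveStay)].

Lemma perform_idle ts : perform (idle (heads_of ts)) ts = ts.
Proof. by apply/ffunP => i; rewrite !ffunE /=; case: (ts i). Qed.

Lemma head_rep s ts r : r <= K -> rep s ts -> heads_of ts (inord r) = ohead (s r).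
Proof.
move=> rK /(_ (inord r)); rewrite ffunE inordK // => -[m].
by case: (s r) => [|a l]; case: m => [|m] //= [->].
Qed.

Lemma tape_rep_left a s T : tape_rep s T ->
  tape_rep (a :: s) (tape_write (Some a) (tape_move MoveLeft T)).
Proof.
case: T => l h r [m /= E].
by exists m => /=; rewrite -E; case: l.
Qed.

Lemma tape_rep_right s T : tape_rep s T -> tape_rep (behead s) (tape_move MoveRight T).
Proof.
case: T => l h r [m /= E]; rewrite /tape_rep.
have {E m} : exists m, r = map Some (behead s) ++ nseq m None.
  case: s E => [|a s] /=; last by case=> _ ->; exists m.
  by case: m => // m [_ ->]; exists m.
case=> {}m; case: r => [E|b r ->]; last by exists m.
by exists 1; case: (behead s) E => //; case: m.
Qed.

Definition fskip : frag := @Frag unit tt (fun _ h => (None, idle h)).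

Lemma reach_skip s : reach fskip s 1 s.
Proof.
move=> ts tsP; exists ts => //; apply: FStep; rewrite /= perform_idle.
exact: FDone.
Qed.

Definition fpop r : frag :=
  @Frag unit tt (fun _ h => (None, [ffun i : 'I_K.+1 =>
    if val i == r then (h i, MoveRight) else (h i, MoveStay)])).

Lemma reach_pop r s : reach (fpop r) s 1 (fupd s r (behead (s r))).
Proof.
move=> ts tsP; eexists; first by apply: FStep => /=; apply: FDone.
move=> i; rewrite !ffunE /fupd; case: eqP => [<-|_].
  move: (tape_rep_right (tsP i)); rewrite /=.
  by case: (ts i).
by have := tsP i; case: (ts i).
Qed.

(** A transition writes before it moves, so stepping left and then writing take two transitions. *)
Definition fpush r a : frag :=
  @Frag bool false (fun q h => if q then (None, act_at r h (Some a, MoveStay))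
    else (Some true, [ffun i : 'I_K.+1 =>
    if val i == r then (h i, MoveLeft) else (h i, MoveStay)])).

Lemma reach_push r a s : reach (fpush r a) s 2 (fupd s r (a :: s r)).
Proof.
move=> ts tsP; eexists; first by do 2 (apply: FStep => /=); apply: FDone.
move=> i; rewrite !ffunE /fupd /=; case: eqP => [<-|_].
  move: (tape_rep_left a (tsP i)); rewrite /=.
  by case: (ts i) => -[].
by have := tsP i; case: (ts i).
Qed.

Definition fseq f g : frag :=
  @Frag (fstate f + fstate g)%type (inl (fstart f)) (fun q h =>
    match q with
    | inl q => (if (fdelta q h).1 is Some q' then Some (inl q') else Some (inr (fstart g)),
                (fdelta q h).2)
    | inr q => (if (fdelta q h).1 is Some q' then Some (inr q') else None,
                (fdelta q h).2)
    end).

Lemma reach_seq f g s t s1 t' s2 :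
  reach f s t s1 -> reach g s1 t' s2 -> reach (fseq f g) s (t + t') s2.
Proof.
move=> R1 R2 ts /R1[ts1 run1 /R2[ts2 run2 ts2P]]; exists ts2 => //.
apply: (@frun_embed f (fseq f g) inl (Some (inr (fstart g))) _ _ _ _ _ run1) => //.
rewrite -(addn0 t').
by apply: (@frun_embed g (fseq f g) inr None _ _ _ _ _ run2) => //; apply: FDone.
Qed.

Definition fcase r (f : option A -> frag) : frag :=
  @Frag (option {a : option A & fstate (f a)}) None (fun q h =>
    match q with
    | None => let a := h (inord r) in (Some (Some (Tagged (fun a => fstate (f a)) (fstart (f a)))), idle h)
    | Some (existT a q) =>
      (if (fdelta q h).1 is Some q' then Some (Some (Tagged (fun a => fstate (f a)) q')) else None,
       (fdelta q h).2)
    end).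

Lemma reach_case r f s t s' : r <= K ->
  reach (f (ohead (s r))) s t s' -> reach (fcase r f) s t.+1 s'.
Proof.
move=> rK R ts tsP; have [ts' run ts'P] := R _ tsP; exists ts' => //.
apply: FStep => /=; rewrite perform_idle (head_rep rK tsP) -(addn0 t).
pose phi (q : fstate (f (ohead (s r)))) : fstate (fcase r f) :=
  Some (Tagged (fun a => fstate (f a)) q).
by apply: (@frun_embed _ (fcase r f) phi None _ _ _ _ _ run) => //; apply: FDone.
Qed.

Definition fwhile r f : frag :=
  @Frag (option (fstate f)) None (fun q h =>
    match q with
    | None => (if h (inord r) is Some _ then Some (Some (fstart f)) else None, idle h)
    | Some q => (Some (fdelta q h).1, (fdelta q h).2)
    end).

Lemma reach_while_nil r f s : r <= K -> s r = [::] -> reach (fwhile r f) s 1 s.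
Proof.
move=> rK sr ts tsP; exists ts => //; apply: FStep => /=.
by rewrite perform_idle (head_rep rK tsP) sr; apply: FDone.
Qed.

Lemma reach_while_cons r f s t s1 t' s2 : r <= K -> s r <> [::] ->
  reach f s t s1 -> reach (fwhile r f) s1 t' s2 ->
  reach (fwhile r f) s (t + t').+1 s2.
Proof.
move=> rK sr R1 R2 ts tsP.
have [ts1 run1 ts1P] := R1 _ tsP; have [ts2 run2 ts2P] := R2 _ ts1P.
exists ts2 => //; apply: FStep => /=; rewrite perform_idle (head_rep rK tsP).
case: (s r) sr => //= a l _.
apply: (@frun_embed f (fwhile r f) Some (Some None) _ _ _ _ _ run1) => //.
by move=> q h /=; case: (fdelta q h) => -[].
Qed.

Definition fmv x y : frag :=
  fcase x (fun o => if o is Some a then fseq (fpop x) (fpush y a) else fskip).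

Lemma reach_mv x y a l s : x <= K -> x != y -> s x = a :: l ->
  reach (fmv x y) s 4 (fupd (fupd s x l) y (a :: s y)).
Proof.
move=> xK xy sx; apply: reach_case => //; rewrite sx /=.
apply: eq_reach (reach_seq (@reach_pop x s) (@reach_push y a _)) => // i.
by rewrite /fupd sx /= [y == x]eq_sym (negPf xy).
Qed.

(* The clock of the loops of nesting level [l] is the pair of registers
   [m + 2 * l] and [m + 2 * l + 1]; it holds as many letters as the input. *)
Fixpoint compile m l c : frag :=
  match c with
  | Skip => fskip
  | Push r a => fpush r a
  | Pop r => fpop r
  | Seq c1 c2 => fseq (compile m l c1) (compile m l c2)
  | Case r f => fcase r (fun a => compile m l (f a))
  | Loop c => let x := m + l.*2 in
    fseq (fwhile x (fseq (fmv x x.+1) (compile m l.+1 c)))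
         (fwhile x.+1 (fmv x.+1 x))
  end.

Lemma reach_while_mv x y s : x <= K -> x != y ->
  reach (fwhile x (fmv x y)) s (5 * size (s x) + 1)
    (fupd (fupd s x [::]) y (rev (s x) ++ s y)).
Proof.
move=> xK xy; move sxE: (s x) => l; elim: l s sxE => [|a l IH] s sx.
  apply: eq_reach (reach_while_nil _ xK sx) => // i.
  by rewrite /fupd; case: eqP => [->|_] //; case: eqP => [->|_].
have -> : 5 * size (a :: l) + 1 = (4 + (5 * size l + 1)).+1 by rewrite /=; lia.
have mvP := reach_mv xK xy sx.
have := IH (fupd (fupd s x l) y (a :: s y)).
rewrite {1}/fupd (negPf xy) /fupd eqxx => /(_ erefl) R.
apply: eq_reach (reach_while_cons xK _ mvP R) => [//|i|]; last by rewrite sx.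
by rewrite /= eqxx rev_cons cat_rcons; case: (i == y); case: (i == x).
Qed.

(** Registers below [m] belong to the program, the others to the clocks. *)
Definition mix m (s : store) (S : nat -> seq A) : nat -> seq A :=
  fun r => if r < m then get s r else S r.

(** Only clocks of level at least [l] are full: those of the enclosing loops are partly spent while
    an inner command runs. *)
Definition clocked m l D (clk : seq A) (S : nat -> seq A) : Prop :=
  forall d, l <= d < D -> S (m + d.*2) = clk /\ S (m + d.*2).+1 = [::].

Lemma get_upd s r v i : get (upd s r v) i = if i == r then v else get s i.
Proof. by rewrite /get nth_set_nth. Qed.

(** The same [S] stands before and after: every loop restores its own clock, so the body of an outer
    loop can be run again. *)
Lemma reach_compile m D clk n c : size clk = n -> m + D.*2 <= K.+1 ->
  forall l s S, width c <= m -> l + depth c <= D -> clocked m l D clk S ->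
  exists2 t, t <= cost n c & reach (compile m l c) (mix m s S) t (mix m (den n c s) S).
Proof.
move=> clkn mK; elim: c => /= [|r a|r|c1 IH1 c2 IH2|r f IH|c IH] l s S w dp clkS.
- by exists 1 => //; apply: reach_skip.
- exists 2 => //; apply: eq_reach (@reach_push r a (mix m s S)) => // i.
  by rewrite /fupd /mix get_upd w; case: eqP => // ->; rewrite w.
- exists 1 => //; apply: eq_reach (@reach_pop r (mix m s S)) => // i.
  by rewrite /fupd /mix get_upd w; case: eqP => // ->; rewrite w.
- have [|||t1 le1 R1] := IH1 l s S => //; try lia.
  have [|||t2 le2 R2] := IH2 l (den n c1 s) S => //; try lia.
  by exists (t1 + t2); [lia|apply: reach_seq R1 R2].
- have rm : r < m by lia.
  have [||//|t le R] := IH (ohead (get s r)) l s S.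
  + by apply: leq_trans (leq_trans _ (leq_maxr r.+1 _)) w; apply: leq_bigmax.
  + by apply: leq_trans dp; rewrite leq_add2l; apply: (leq_bigmax (F := fun a => depth (f a))).
  exists t.+1; first by rewrite ltnS (leq_trans le) //; apply: (leq_bigmax (F := fun a => cost n (f a))).
  by apply: reach_case; [lia|rewrite {1}/mix rm].
have [xclk yclk] : S (m + l.*2) = clk /\ S (m + l.*2).+1 = [::] by apply: clkS; lia.
set x := m + l.*2 in xclk yclk *.
have xK : x.+1 <= K by lia.
have xm : (x < m) = false by lia.
have x1m : (x.+1 < m) = false by lia.
have neq1 : (x == x.+1) = false by lia.
have neq2 : (x.+1 == x) = false by lia.
(* The clock in the middle of a loop: [v] is still to be spent, [u] has been moved over and thereby
   reversed. *)
pose C u v := fupd (fupd S x v) x.+1 (rev u).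
have iterP v u s1 : clk = u ++ v ->
  exists2 t, t <= size v * (cost n c + 5) + 1 &
    reach (fwhile x (fseq (fmv x x.+1) (compile m l.+1 c)))
      (mix m s1 (C u v)) t (mix m (iter (size v) (den n c) s1) (C clk [::])).
  elim: v u s1 => [|a v IHv] u s1 clkE.
    exists 1 => //; rewrite cats0 in clkE; rewrite clkE /=.
    by apply: reach_while_nil; [lia|rewrite /mix xm /C /fupd neq1 eqxx].
  have [|||t1 le1 R1] := IH l.+1 s1 (C (rcons u a) v); [lia|lia| |].
    move=> d dlt; rewrite /C /fupd /x.
    by rewrite !ifN; [apply: clkS; lia|lia|lia|lia|lia].
  have [|t2 le2 R2] := IHv (rcons u a) (den n c s1); first by rewrite cat_rcons.
  exists (4 + t1 + t2).+1; first by rewrite /= mulSn; lia.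
  rewrite [iter _ _ _]iterSr; apply: reach_while_cons R2; [lia| |].
    by rewrite /mix xm /C /fupd neq1 eqxx.
  apply: reach_seq R1.
  have [] : x <= K /\ x != x.+1 by lia.
  move=> xK' xne; have sx : mix m s1 (C u (a :: v)) x = a :: v.
    by rewrite /mix xm /C /fupd neq1 eqxx.
  apply: eq_reach (reach_mv xK' xne sx) => // i.
  rewrite /fupd /mix /C /fupd x1m eqxx rev_rcons.
  case: eqP => [->|i1]; first by rewrite x1m.
  by case: eqP => [->|i2]; first by rewrite xm.
have [t1 le1 R1] := iterP clk [::] s erefl.
(* Moving the spent letters back reverses them a second time, so the clock regains exactly its old
   content. *)
have := @reach_while_mv x.+1 x (mix m (iter n (den n c) s) (C clk [::])).
rewrite neq2 => /(_ xK isT) R2.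
exists (t1 + (5 * n + 1)); first by rewrite clkn in le1; lia.
rewrite clkn in R1.
apply: reach_seq; first apply: eq_reach R1 => // i.
  rewrite /mix; case: ltnP => // mi; rewrite /C /fupd.
  by do 2 (case: eqP => [->|_] //).
have sz : size (mix m (iter n (den n c) s) (C clk [::]) x.+1) = n.
  by rewrite /mix x1m /C /fupd eqxx size_rev.
rewrite sz in R2; apply: eq_reach R2 => // i.
rewrite /fupd /mix /C /fupd x1m xm eqxx revK neq1 eqxx cats0.
case: eqP => [->|i1]; first by rewrite xm.
by case: eqP => [->|i2]; first by rewrite x1m.
Qed.


(** * Copying the input to the clocks *)

Definition pushes (rs : seq nat) a : frag :=
  foldr (fun r f => fseq (fpush r a) f) fskip rs.

Lemma reach_pushes rs a s : uniq rs ->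
  reach (pushes rs a) s ((size rs).*2.+1) (fun i => if i \in rs then a :: s i else s i).
Proof.
elim: rs s => [|r rs IH] s /=; first by move=> _; apply: reach_skip.
case/andP=> rNrs /IH{}IH; rewrite doubleS -add2n addnS.
apply: eq_reach (reach_seq (@reach_push r a s) (IH _)) => // i.
rewrite /fupd inE; case: eqP => [->|_] //=.
by rewrite (negPf rNrs).
Qed.

Definition distribute x rs : frag :=
  fwhile x (fcase x (fun o => if o is Some a then fseq (fpop x) (pushes rs a) else fskip)).

Lemma reach_distribute x rs s : x <= K -> uniq rs -> x \notin rs ->
  reach (distribute x rs) s (size (s x) * ((size rs).*2 + 4) + 1)
    (fun i => if i == x then [::] else if i \in rs then rev (s x) ++ s i else s i).
Proof.
move=> xK rsU xNrs; move sxE: (s x) => l; elim: l s sxE => [|a l IH] s sx.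
  apply: eq_reach (reach_while_nil _ xK sx) => // i.
  by case: eqP => [->|_] //; case: ifP.
have -> : size (a :: l) * ((size rs).*2 + 4) + 1 =
  ((1 + (size rs).*2.+1).+1 + (size l * ((size rs).*2 + 4) + 1)).+1 by rewrite /=; lia.
pose s1 i := if i \in rs then a :: fupd s x l i else fupd s x l i.
have R1 : reach (fcase x (fun o => if o is Some a then fseq (fpop x) (pushes rs a) else fskip))
            s (1 + (size rs).*2.+1).+1 s1.
  apply: reach_case => //; rewrite sx /=.
  apply: reach_seq (@reach_pushes rs a (fupd s x l) rsU).
  by apply: eq_reach (@reach_pop x s) => // i; rewrite sx.
have := IH s1; rewrite {1}/s1 (negPf xNrs) /fupd eqxx => /(_ erefl) R2.
apply: eq_reach (reach_while_cons xK _ R1 R2) => [//|i|]; last by rewrite sx.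
rewrite /s1 /fupd; case: eqP => // _; case: ifP => [->|-> //].
by rewrite rev_cons cat_rcons.
Qed.

(** * Fragments as Turing machines *)

Definition machine (f : frag) : tm :=
  @TM K A (fstate f + option bool)%type (inl (fstart f))
    (fun q => q == inr (Some true))
    (fun q h => match q with
     | inl q => Some (if (fdelta q h).1 is Some q' then inl q' else inr None, (fdelta q h).2)
     | inr None => Some (inr (Some (isSome (h ord0))), idle h)
     | inr (Some _) => None
     end).

Lemma run_machine f t oq ts ts' : @frun f t oq ts ts' ->
  run t (@Config (machine f) (if oq is Some q then inl q else inr None) ts) =
  @Config (machine f) (inr None) ts'.
Proof.
elim=> {t oq ts ts'} // q ts t ts' _ IH.
by rewrite /run iterSr /= -IH.
Qed.

Lemma tape_word_rep s T : tape_rep s T -> tape_word T = s.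
Proof.
case=> m E; rewrite /tape_word E.
have -> : index None (map Some s ++ nseq m None) = size s.
  by elim: s {E} => [|a s IH] /=; [case: m|rewrite IH].
by rewrite -(size_map Some) take_size_cat // map_pK.
Qed.

Lemma run_halted (M : tm) m n (c : config M) :
  m <= n -> halted (run m c) -> run n c = run m c.
Proof.
move=> /subnK <- H; rewrite /run iterD -/(run m c).
by elim: (n - m) => //= k ->; rewrite H.
Qed.

(** Leaving the fragment costs one further step, which inspects register 0 to choose the halting
    state; hence the strict bound. *)
Lemma machineP f w t s' n : t < n ->
  reach f (fun r => if r == 0 then w else [::]) t s' ->
  let final := run n (@init (machine f) w) in
  [/\ halted final, tape_word (conf_tapes final ord0) = s' 0 &
      tm_accept (conf_state final) = (s' 0 != [::])].
Proof.
move=> tn R /=.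
have [|ts run1 tsP] := R [ffun i => if i == ord0 then tape_of w else tape_of [::]].
  move=> i; rewrite ffunE -val_eqE /=; case: eqP => _; last by exists 1.
  by case: (w) => [|a v]; [exists 1|exists 0; rewrite cats0].
have run2 : run t.+1 (@init (machine f) w) =
    @Config (machine f) (inr (Some (s' 0 != [::]))) ts.
  rewrite /run iterS -/(run _ _) (run_machine run1) /=; congr Config; last first.
    by rewrite -[RHS]perform_idle.
  congr (inr (Some _)); rewrite ffunE.
  have := head_rep (leq0n K) tsP; rewrite ffunE.
  have -> : inord 0 = ord0 :> 'I_K.+1 by apply/val_inj; rewrite /= inordK.
  by move=> ->; case: (s' 0).
have H : halted (run t.+1 (@init (machine f) w)) by rewrite run2.
rewrite (run_halted tn H); split=> //; rewrite run2 /=; last by case: (s' 0 != _).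
by apply: tape_word_rep; apply: tsP.
Qed.

End StackPrograms.

(* Register [0] holds the input and then the output; a word is accepted when
   the output is nonempty. *)
Theorem program_machine (A : finType) (c : cmd A) (k : nat) :
  exists (M : tm) (i : A -> tm_alphabet M) (b d : nat), injective i /\ forall w : seq A,
  let final := run (poly_bound b d (size w)) (@init M (map i w)) in
  let out := get (den (size w) c (w :: nseq k [::])) 0 in
  [/\ halted final,
      tape_word (conf_tapes final ord0) = map i out &
      tm_accept (conf_state final) = (out != [::])].
Proof.
(* The successor keeps register 0 below [m] even when [c] mentions no register. Register [K], just
   past the clocks, is scratch space for copying the input. *)
pose m := (width c).+1; pose D := depth c; pose K := m + D.*2.
pose rs := 0 :: [seq m + d.*2 | d <- iota 0 D].
(* The input goes to [K] in reverse, and a second reversal takes it from there to register 0 and to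
   the first register of every clock. *)
pose f := fseq (fseq (fwhile 0 (@fmv A K 0 K)) (@distribute A K K rs)) (@compile A K m 0 c).
pose T n := (5 * n + 1) + (n * ((size rs).*2 + 4) + 1) + cost n c + 1.
have [|b [d TP]] := @polybP T.
  apply: polyb_add (polyb_const 1); apply: polyb_add (polyb_cost c).
  apply: polyb_add; apply: polyb_add (polyb_const 1).
    exact: polyb_mul (polyb_const 5) polyb_id.
  exact: polyb_mul polyb_id (polyb_const _).
exists (machine f), id, b, d; split=> // w /=; rewrite !map_id.
pose s0 := fun r => if r == 0 then w else [::].
have rsU : uniq rs.
  rewrite /= map_inj_uniq ?iota_uniq ?andbT; last by move=> i j; lia.
  by apply/mapP => -[].
have KNrs : K \notin rs.
  rewrite inE negb_or; apply/andP; split=> //; apply/mapP => -[i].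
  by rewrite mem_iota /K; lia.
have R1 := @reach_while_mv A K 0 K s0 (leq0n K) isT.
have R2 := @reach_distribute A K K rs
   (fupd (fupd s0 0 [::]) K (rev (s0 0) ++ s0 K)) (leqnn K) rsU KNrs.
pose S r := if r \in rs then w else [::].
have [|//|//|//|t tle R3] := @reach_compile A K m D w (size w) c erefl _ 0 (w :: nseq k [::]) S.
- by rewrite /K.
- move=> i iD; rewrite /S; split.
    rewrite inE orbC (_ : _ \in _) //; apply/mapP; exists i => //.
    by rewrite mem_iota; lia.
  rewrite ifN // inE negb_or; apply/andP; split=> //; apply/mapP => -[j _]; lia.
have R12 := reach_seq R1 R2.
have {R12} R := reach_seq (eq_reach (fun i => erefl) _ R12) R3.
have := @machineP A K f w _ _ (poly_bound b d (size w)) _ (R _).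
rewrite /mix /=; apply.
- apply: leq_trans (TP _); rewrite /T /fupd eqxx size_cat size_rev addn0.
  by rewrite -[size (s0 0)]/(size w); move: (size rs) (size w * _); lia.
- move=> i; rewrite /fupd eqxx cats0 revK /S.
  have -> : s0 0 = w by [].
  case: (eqVneq i K) => [->|iK].
    by rewrite (negPf KNrs) ifN // /K; lia.
  have s00 : (if i == 0 then [::] else s0 i) = [::] by rewrite /s0; case: eqP.
  rewrite s00 cats0; case: ltnP => // im.
  have -> : (i \in rs) = (i == 0).
    by rewrite inE; case: eqP => //= _; apply/mapP => -[j _]; lia.
  by case: i {iK im s00} => [|i] //; rewrite /get /= nth_nseq if_same.
Qed.


(** * AD-relations *)

Section ADRelations.
Context (A : Type).
Implicit Types (r q : adrel A) (x u v : seq A).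

Lemma ad_mem_size r x : ad_mem r x -> size x = arity r.
Proof. by case=> t <- _; rewrite size_tuple. Qed.

Lemma ad_mem_set k (P : seq A -> Prop) x :
  ad_mem (ad_set k P) x <-> size x = k /\ P x.
Proof.
split=> [xP|[/eqP xk Px]]; last by exists (Tuple xk).
by split; [apply: ad_mem_size xP|case: xP => t <-].
Qed.

Lemma ad_mem_neg r x : size x = arity r -> ad_mem (ad_neg r) x <-> ~ ad_mem r x.
Proof. by move=> xr; rewrite ad_mem_set; tauto. Qed.

Lemma ad_mem_J r q u v : size u = arity r ->
  ad_mem (ad_J r q) (u ++ v) <-> ad_mem r u /\ ad_mem q v.
Proof.
move=> ur; rewrite ad_mem_set; split=> [[_ [u' [v' [E ru qv]]]]|[ru qv]].
  have uu' : size u' = size u by rewrite ur (ad_mem_size ru).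
  have := take_size_cat v' uu'; have := drop_size_cat v' uu'.
  by rewrite -E take_size_cat // drop_size_cat // => -> ->.
by rewrite size_cat ur (ad_mem_size qv); split=> //; exists u, v.
Qed.

End ADRelations.

(** * Propositional formulas as terms *)

Section Formulas.

Inductive form (V : Type) := Tru | Atom of V | Not of form V | And of form V & form V.

Fixpoint fmap V W (g : V -> W) (f : form V) : form W :=
  match f with
  | Tru => Tru W
  | Atom v => Atom (g v)
  | Not f => Not (fmap g f)
  | And f1 f2 => And (fmap g f1) (fmap g f2)
  end.

Fixpoint eval V (rho : V -> bool) (f : form V) : bool :=
  match f with
  | Tru => true
  | Atom v => rho v
  | Not f => ~~ eval rho f
  | And f1 f2 => eval rho f1 && eval rho f2
  end.

Lemma eval_fmap V W (g : V -> W) rho f : eval rho (fmap g f) = eval (rho \o g) f.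
Proof. by elim: f => //= [f ->|f1 -> f2 ->]. Qed.

Definition Or V (f g : form V) := Not (And (Not f) (Not g)).
Definition Imp V (f g : form V) := Not (And f (Not g)).
Definition Iff V (f g : form V) := And (Imp f g) (Imp g f).
Definition Lit V b (f : form V) := if b then f else Not f.
Definition Conj V I (s : seq I) (F : I -> form V) : form V :=
  foldr (fun i f => And (F i) f) (Tru V) s.


Lemma eval_Or V rho (f g : form V) : eval rho (Or f g) = eval rho f || eval rho g.
Proof. by rewrite /Or /= negb_and !negbK. Qed.

Lemma eval_Imp V rho (f g : form V) : eval rho (Imp f g) = (eval rho f ==> eval rho g).
Proof. by rewrite /Imp /= negb_and negbK implybE. Qed.

Lemma eval_Iff V rho (f g : form V) : eval rho (Iff f g) = (eval rho f == eval rho g).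
Proof. by rewrite /Iff /Imp /=; case: (eval rho f); case: (eval rho g). Qed.

Lemma eval_Lit V b rho (f : form V) : eval rho (Lit b f) = (eval rho f == b).
Proof. by case: b => /=; rewrite ?eqb_id ?eqbF_neg. Qed.

Lemma eval_Conj V I rho (s : seq I) (F : I -> form V) :
  eval rho (Conj s F) = all (fun i => eval rho (F i)) s.
Proof. by elim: s => //= i s ->. Qed.

Lemma eval_enum V (I : finType) rho (F : I -> form V) :
  reflect (forall i, eval rho (F i)) (eval rho (Conj (enum I) F)).
Proof.
rewrite eval_Conj; apply: (iffP allP) => [FP i|FP i _]; last exact: FP.
by apply: FP; rewrite mem_enum.
Qed.

Context (V : Type) (name : V -> seq bool).

(* The relation symbols of arity [0] serve as propositional variables. *)
Fixpoint term_of (f : form V) : term :=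
  match f with
  | Tru => TermNeg (TermJ (Rel 0 [::]) (TermNeg (Rel 0 [::])))
  | Atom v => Rel 0 (name v)
  | Not f => TermNeg (term_of f)
  | And f1 f2 => TermJ (term_of f1) (term_of f2)
  end.

Lemma interp_term_of (A : model) (rho : V -> bool) f :
  (forall v, rho v <-> @rel_interp A 0 (name v) [tuple]) ->
  arity (interp A (term_of f)) = 0 /\ (ad_mem (interp A (term_of f)) [::] <-> eval rho f).
Proof.
move=> rhoP; elim: f => [|v|f [ar IH]|f1 [ar1 IH1] f2 [ar2 IH2]]; split=> //=.
- rewrite ad_mem_neg // (@ad_mem_J _ _ _ [::] [::]) // ad_mem_neg //.
  by split=> // _ [].
- rewrite rhoP; split=> [[t _]|r]; last by exists [tuple].
  by rewrite (tuple0 t).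
- rewrite ad_mem_neg // IH; split; first by move/negP.
  by move=> /negP.
- by rewrite /ad_J /= ar1 ar2.
- rewrite (@ad_mem_J _ _ _ [::] [::]) // IH1 IH2.
  by split=> [[-> ->]|/andP].
Qed.

(** The only tuple of length 0 is the empty one, so a model matters only through one truth value per
    symbol; injective names let every valuation arise, over a domain with a single element. *)
Lemma satisfiable_term_of f : injective name ->
  satisfiable (term_of f) <-> exists rho, eval rho f.
Proof.
move=> name_inj; split=> [[A [x xP]]|[rho rhof]].
  pose rho v : bool := excluded_middle_informative (@rel_interp A 0 (name v) [tuple]).
  exists rho; have [|ar fP] := @interp_term_of A rho f.
    by move=> v; rewrite /rho; case: excluded_middle_informative.
  by apply/fP; move: xP (ad_mem_size xP); rewrite ar; case: x.
pose A := @Model unit (inhabits tt) (fun k x _ => exists2 v, x = name v & rho v).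
have [|_ fP] := @interp_term_of A rho f; last by exists A, [::]; apply/fP.
by move=> v; split=> [|[v' /name_inj <-] //]; exists v.
Qed.

End Formulas.

#[global] Opaque Or Imp Iff Lit Conj.

(** * The tableau of a Turing machine *)

Section Tableau.
Context (S : finType) (M : tm) (emb : S + bool -> tm_alphabet M).
Notation G := (tm_alphabet M).
Notation Q := (tm_state M).
Notation I := 'I_(tm_tapes M).+1.

(* Cells are addressed relative to the head, as in [tape]: the side is [None]
   for the head itself, [Some false] for the left and [Some true] for the
   right.  The last summand describes the input word. *)
Definition quantity : finType := (Q + (option bool * I * option G) + option G)%type.

(* In a template, an atom refers to the current time or the next one, and to the
   current index, the next index or (for [None]) index [0]. *)
Definition tatom : Type := quantity * bool * option bool.
Definition atom : Type := quantity * nat * nat.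

Definition index_of j (dj : option bool) : nat :=
  if dj is Some b then if b then j.+1 else j else 0.

Definition inst t j (x : tatom) : atom :=
  let: (x, dt, dj) := x in
  (x, if dt then t.+1 else t, index_of j dj).

Definition xstate (q : Q) : quantity := inl (inl q).
Definition xcell d (i : I) (a : option G) : quantity := inl (inr (d, i, a)).
Definition xinput (a : option G) : quantity := inr a.

(** A halted machine idles, in agreement with [run], so that every time up to the bound is described
    by the same step formula. *)
Definition next (q : Q) (h : {ffun I -> option G}) : Q * {ffun I -> option G * move} :=
  if tm_delta q h is Some qa then qa else (q, [ffun i => (h i, MoveStay)]).

Definition view (c : config M) : {ffun I -> option G} := [ffun i => tape_head (conf_tapes c i)].

Definition next_config (c : config M) : config M :=
  let: (q, act) := next (conf_state c) (view c) in
  Config q [ffun i => tape_move (act i).2 (tape_write (act i).1 (conf_tapes c i))].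

Lemma next_configE c : odflt c (step c) = next_config c.
Proof.
case: c => q ts; rewrite /next_config /next /view /=.
case: tm_delta => [[q' act]|] //=; congr Config; apply/ffunP => i.
by rewrite !ffunE /=; case: (ts i).
Qed.

Definition side (d : option bool) (T : tape G) j : option G :=
  match d with
  | None => tape_head T
  | Some false => nth None (tape_left T) j
  | Some true => nth None (tape_right T) j
  end.

(* Each cell of the next tape listed here comes with the cell of the present
   tape that it copies, or with [None] if it receives the letter written. *)
Definition sources m : seq (option bool * option bool * option (bool * option bool)) :=
  let shift r := [:: (Some (~~ r), None, None);
                     (Some (~~ r), Some true, Some (~~ r, Some false));
                     (None, None, Some (r, None));
                     (Some r, Some false, Some (r, Some true))] in
  match m with
  | MoveStay => [:: (None, None, None);
                    (Some false, Some false, Some (false, Some false));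
                    (Some true, Some false, Some (true, Some false))]
  | MoveLeft => shift false
  | MoveRight => shift true
  end.

Definition source_val j b (T : tape G) (o : option (bool * option bool)) : option G :=
  if o is Some (r, dj) then side (Some r) T (index_of j dj) else b.

Lemma side_move j m b (T : tape G) d dj o : (d, dj, o) \in sources m ->
  side d (tape_move m (tape_write b T)) (index_of j dj) = source_val j b T o.
Proof.
case: m T => -[[|b0 l] h [|b1 r]];
  rewrite !in_cons in_nil; do ?[case/predU1P=> [[-> -> ->]|] //=]; rewrite ?nth_nil //.
Qed.

Arguments side : simpl never.

Definition move_form (i : I) (bm : option G * move) : form tatom :=
  Conj (sources bm.2) (fun x => let: (d, dj, o) := x in
    Conj (enum {: option G}) (fun a =>
      let new := Atom (xcell d i a, true, dj) in
      if o is Some (r, dj') then Iff new (Atom (xcell (Some r) i a, false, dj'))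
      else Lit (a == bm.1) new)).

Definition step_form : form tatom :=
  Conj (enum {: Q * {ffun I -> option G}}) (fun l =>
    Imp (And (Atom (xstate l.1, false, None))
             (Conj (enum I) (fun i => Atom (xcell None i (l.2 i), false, None))))
        (And (Conj (enum Q) (fun q => Lit (q == (next l.1 l.2).1) (Atom (xstate q, true, None))))
             (Conj (enum I) (fun i => move_form i ((next l.1 l.2).2 i))))).

Implicit Types (rho : atom -> bool) (c : config M).

Definition pinned_cell rho t i (T : tape G) (d : option bool) j : Prop :=
  forall a, rho (xcell d i a, t, j) = (a == side d T j).

Definition pinned rho t b c : Prop :=
  [/\ forall q, rho (xstate q, t, 0) = (q == conf_state c),
      forall i, pinned_cell rho t i (conf_tapes c i) None 0 &
      forall i r j, j < b -> pinned_cell rho t i (conf_tapes c i) (Some r) j].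

Lemma eval_move_form rho t j i (T : tape G) bm :
  (forall r dj, pinned_cell rho t i T (Some r) (index_of j dj)) ->
  eval rho (fmap (inst t j) (move_form i bm)) <->
  (forall d dj o, (d, dj, o) \in sources bm.2 ->
     pinned_cell rho t.+1 i (tape_move bm.2 (tape_write bm.1 T)) d (index_of j dj)).
Proof.
move=> R; rewrite eval_fmap eval_Conj.
have E d dj o : (d, dj, o) \in sources bm.2 ->
  eval (rho \o inst t j) (Conj (enum {: option G}) (fun a =>
      let new := Atom (xcell d i a, true, dj) in
      if o is Some (r, dj') then Iff new (Atom (xcell (Some r) i a, false, dj'))
      else Lit (a == bm.1) new)) <->
  pinned_cell rho t.+1 i (tape_move bm.2 (tape_write bm.1 T)) d (index_of j dj).
  move=> src; split=> [/eval_enum H a|H].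
    rewrite (side_move j _ _ src); move: (H a); case: o {H src} => [[r dj']|] /=.
      by rewrite eval_Iff /= R => /eqP.
    by rewrite eval_Lit /= => /eqP.
  apply/eval_enum => a; have := H a.
  rewrite (side_move j _ _ src); case: o {H src} => [[r dj']|] /= H.
    by rewrite eval_Iff /= R H.
  by rewrite eval_Lit /= H.
split=> [/allP H d dj o src|H].
  by apply/(E _ _ o src)/(H _ src).
by apply/allP => -[[d dj] o] src; apply/(E _ _ o src)/(H _ _ _ src).
Qed.

Lemma eval_step_form rho t j c :
  (forall q, rho (xstate q, t, 0) = (q == conf_state c)) ->
  (forall i, pinned_cell rho t i (conf_tapes c i) None 0) ->
  (forall i r dj, pinned_cell rho t i (conf_tapes c i) (Some r) (index_of j dj)) ->
  eval rho (fmap (inst t j) step_form) <->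
  (forall q, rho (xstate q, t.+1, 0) = (q == conf_state (next_config c))) /\
  (forall i d dj o, (d, dj, o) \in sources ((next (conf_state c) (view c)).2 i).2 ->
     pinned_cell rho t.+1 i (conf_tapes (next_config c) i) d (index_of j dj)).
Proof.
move=> Rq Rh Rs.
(* Of all implications in [step_form], only the one for the actual state and letters has a true
   premise. *)
pose l0 := (conf_state c, view c).
have localP (l : Q * {ffun I -> option G}) :
    eval (rho \o inst t j) (And (Atom (xstate l.1, false, None))
      (Conj (enum I) (fun i => Atom (xcell None i (l.2 i), false, None)))) = (l == l0).
  case: l => q h; rewrite /= Rq xpair_eqE; congr andb.
  apply/eval_enum/eqP => [H|-> i /=]; last by rewrite Rh /view ffunE.
  by apply/ffunP => i; have := H i; rewrite /= Rh /view ffunE => /eqP.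
have E : eval rho (fmap (inst t j) step_form) <->
  eval (rho \o inst t j) (And
    (Conj (enum Q) (fun q => Lit (q == (next l0.1 l0.2).1) (Atom (xstate q, true, None))))
    (Conj (enum I) (fun i => move_form i ((next l0.1 l0.2).2 i)))).
  rewrite eval_fmap; split=> [/eval_enum/(_ l0)|H].
    by rewrite eval_Imp localP eqxx.
  by apply/eval_enum => l; rewrite eval_Imp localP; apply/implyP => /eqP ->.
rewrite E /next_config /l0 /=; case: (next _ _) => q' act /=.
split=> [/andP[/eval_enum Hq /eval_enum Hm]|[Hq Hm]].
  split=> [q|i d dj o src]; first by have := Hq q; rewrite eval_Lit /= => /eqP.
  rewrite ffunE; have := Hm i; rewrite -eval_fmap.
  by move/(eval_move_form (T := conf_tapes c i) _ (Rs i)); apply; apply: src.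
apply/andP; split; first by apply/eval_enum => q; rewrite eval_Lit /= Hq.
apply/eval_enum => i; rewrite -eval_fmap.
apply/(eval_move_form (T := conf_tapes c i) _ (Rs i)) => d dj o /Hm.
by rewrite ffunE.
Qed.

(** On the side that receives a letter, cell 0 is the letter written and cell [j.+1] is addressed
    from index [j]; any other cell is addressed from its own index. *)
Lemma sources_cover m r b j : j < b ->
  exists j' dj o, [/\ j' < b, (Some r, dj, o) \in sources m & index_of j' dj = j].
Proof.
move=> jb; have keep o : (Some r, Some false, o) \in sources m ->
    exists j' dj o, [/\ j' < b, (Some r, dj, o) \in sources m & index_of j' dj = j].
  by move=> src; exists j, (Some false), o.
have push j' : (Some r, None, None) \in sources m ->
    (Some r, Some true, Some (r, Some false)) \in sources m -> j = j' ->
    exists j' dj o, [/\ j' < b, (Some r, dj, o) \in sources m & index_of j' dj = j].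
  move=> src0 src1 _; case: j jb {keep} => [|j] jb; first by exists 0, None, None.
  by exists j, (Some true), (Some (r, Some false)); split=> //; apply: ltnW.
case: m r keep push => -[] keep push.
- by apply: (push j).
- exact: keep (Some (false, Some true)) _.
- exact: keep (Some (true, Some false)) _.
- exact: keep (Some (false, Some false)) _.
- exact: keep (Some (true, Some true)) _.
- by apply: (push j).
Qed.

Lemma sources_head m : exists dj o, (None, dj, o) \in sources m /\ (dj = None).
Proof.
by case: m; [exists None, (Some (false, None))|exists None, None|exists None, (Some (true, None))].
Qed.

(** Instance [j] may read the present cell [j.+1], so every step costs one cell of the window. *)
Lemma pinned_step rho t b c : 0 < b ->
  (forall j, j < b -> eval rho (fmap (inst t j) step_form)) ->
  pinned rho t b.+1 c -> pinned rho t.+1 b (next_config c).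
Proof.
move=> b0 H [Rq Rh Rs].
have E j : j < b ->
  (forall q, rho (xstate q, t.+1, 0) = (q == conf_state (next_config c))) /\
  (forall i d dj o, (d, dj, o) \in sources ((next (conf_state c) (view c)).2 i).2 ->
     pinned_cell rho t.+1 i (conf_tapes (next_config c) i) d (index_of j dj)).
  move=> jb; apply/(eval_step_form Rq Rh); last exact: H.
  by move=> i r dj; apply: Rs; case: dj => [[]|] //=; lia.
split=> [|i|i r j jb]; first by case: (E 0 b0).
  have [dj [o [src dj0]]] := sources_head ((next (conf_state c) (view c)).2 i).2.
  by have [_ /(_ i _ _ _ src)] := E 0 b0; rewrite dj0.
have [j' [dj [o [jb' src <-]]]] := sources_cover ((next (conf_state c) (view c)).2 i).2 r jb.
by have [_ /(_ i _ _ _ src)] := E j' jb'.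
Qed.

(** On tape 0 the head sees letter 0 of the input and cell [j] to its right holds letter [j.+1].
    Describing the input by atoms of its own lets given letters, guesses and blanks be imposed
    position by position. *)
Definition init_form : form tatom :=
  And (Conj (enum Q) (fun q => Lit (q == tm_start M) (Atom (xstate q, false, None))))
      (Conj (enum I) (fun i => Conj (enum {: option G}) (fun a =>
        And (Lit (a == None) (Atom (xcell (Some false) i a, false, Some false)))
            (if i == ord0 then
               And (Iff (Atom (xcell None i a, false, None)) (Atom (xinput a, false, None)))
                   (Iff (Atom (xcell (Some true) i a, false, Some false))
                        (Atom (xinput a, false, Some true)))
             else
               And (Lit (a == None) (Atom (xcell None i a, false, None)))
                   (Lit (a == None) (Atom (xcell (Some true) i a, false, Some false))))))).

Definition input_form (b : option G) : form tatom :=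
  Conj (enum {: option G}) (fun a => Lit (a == b) (Atom (xinput a, false, Some false))).

(** Certificates may be shorter than the bound: a blank is allowed, provided that the next position
    is blank as well. *)
Definition guess_form : form tatom :=
  Or (input_form (Some (emb (inr true))))
  (Or (input_form (Some (emb (inr false))))
      (And (input_form None) (Atom (xinput None, false, Some true)))).

Definition accept_form : form tatom :=
  Not (Conj (enum Q) (fun q => if tm_accept q then Not (Atom (xstate q, false, None)) else Tru _)).

Definition tableau (w : seq S) (q T B C : nat) : seq (form atom) :=
  let n := size w in
  [seq fmap (inst 0 p.1) (input_form (Some (emb (inl p.2)))) | p <- zip (iota 0 n) w]
  ++ [seq fmap (inst 0 p) guess_form | p <- iota n q]
  ++ [seq fmap (inst 0 p) (input_form None) | p <- iota (n + q) C]
  ++ [seq fmap (inst 0 j) init_form | j <- iota 0 B]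
  ++ [seq fmap (inst t j) step_form | t <- iota 0 T, j <- iota 0 B]
  ++ [:: fmap (inst T 0) accept_form].

Lemma eval_input_form rho j b :
  eval rho (fmap (inst 0 j) (input_form b)) <->
  (forall a, rho (xinput a, 0, j) = (a == b)).
Proof.
rewrite eval_fmap; split=> [/eval_enum H a|H].
  by have := H a; rewrite eval_Lit /= => /eqP.
by apply/eval_enum => a; rewrite eval_Lit /= H.
Qed.

Lemma eval_guess_form rho j :
  eval rho (fmap (inst 0 j) guess_form) <->
  (exists b, forall a, rho (xinput a, 0, j) = (a == Some (emb (inr b)))) \/
  (forall a, rho (xinput a, 0, j) = (a == None)) /\ rho (xinput None, 0, j.+1).
Proof.
have E b : eval (rho \o inst 0 j) (input_form b) = eval rho (fmap (inst 0 j) (input_form b)).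
  by rewrite eval_fmap.
rewrite eval_fmap 2!eval_Or [eval _ (And _ _)]/= !E; split.
  case/or3P=> [/eval_input_form H|/eval_input_form H|/andP[/eval_input_form H N]].
  - by left; exists true.
  - by left; exists false.
  - by right.
case=> [[[] /eval_input_form ->]|[/eval_input_form -> N]] //; first by rewrite orbT.
by rewrite N !orbT.
Qed.

Lemma eval_accept_form rho t b c : pinned rho t b c ->
  eval rho (fmap (inst t 0) accept_form) = tm_accept (conf_state c).
Proof.
case=> Rq _ _; rewrite eval_fmap /= -[RHS]negbK; congr negb.
apply/eval_enum/idP => [/(_ (conf_state c))|H q].
  by case: ifP => //= _; rewrite Rq eqxx.
by case: ifP => //= acc; rewrite Rq; apply: contraNneq H => <-.
Qed.

Lemma side_tape_of (v : seq G) :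
  tape_head (tape_of v) = nth None (map Some v) 0 /\
  forall j, side (Some true) (tape_of v) j = nth None (map Some v) j.+1.
Proof. by case: v => [|a v]; split=> // j; rewrite /side /= ?nth_nil. Qed.

Lemma eval_init_form rho j (v : seq G) :
  (forall p a, p <= j.+1 -> rho (xinput a, 0, p) = (a == nth None (map Some v) p)) ->
  eval rho (fmap (inst 0 j) init_form) <->
  [/\ forall q, rho (xstate q, 0, 0) = (q == tm_start M),
      forall i, pinned_cell rho 0 i (conf_tapes (@init M v) i) None 0 &
      forall i r, pinned_cell rho 0 i (conf_tapes (@init M v) i) (Some r) j].
Proof.
move=> Rin; rewrite eval_fmap /=.
have [hd rg] := side_tape_of v.
have lf (w : seq G) k : side (Some false) (tape_of w) k = None.
  by case: w => [|a w]; rewrite /side /= nth_nil.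
split=> [/andP[/eval_enum Hq /eval_enum Hc]|[Hq Hh Hs]].
  split=> [q|i a|i r a].
  - by have := Hq q; rewrite eval_Lit /= => /eqP.
  - have /eval_enum/(_ a) := Hc i; rewrite ffunE /=.
    case: (i =P ord0) => _ /= /andP[_ /andP[]]; rewrite ?eval_Iff ?eval_Lit /=.
      by rewrite Rin // /side hd => /eqP.
    by move=> /eqP.
  - have /eval_enum/(_ a) := Hc i; rewrite ffunE /=.
    case/andP; rewrite eval_Lit => /eqP /= L.
    case: r; last by rewrite L; case: (i =P ord0) => _; rewrite ?lf // /side /= nth_nil.
    case: (i =P ord0) => _ /= /andP[_]; rewrite ?eval_Iff ?eval_Lit /=.
      by rewrite Rin // rg => /eqP.
    by move=> /eqP ->; rewrite /side /= nth_nil.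
apply/andP; split; first by apply/eval_enum => q; rewrite eval_Lit /= Hq.
apply/eval_enum => i; apply/eval_enum => a /=; rewrite eval_Lit /= Hs ffunE.
have := Hh i a; have := Hs i true a; rewrite !ffunE.
case: (eqVneq i ord0) => [->|_] /=; rewrite ?eval_Iff ?eval_Lit /= => -> ->.
  by rewrite lf !Rin // rg /side hd !eqxx.
by rewrite /side /= !nth_nil !eqxx.
Qed.


Definition input_word (w : seq S) (u : seq bool) : seq G :=
  map emb (map inl w ++ map inr u).

Lemma run_next n c : run n c = iter n next_config c.
Proof. by rewrite /run; elim: n => //= n ->; rewrite next_configE. Qed.

Lemma guess_word rho n q B :
  (forall p, p < q -> eval rho (fmap (inst 0 (n + p)) guess_form)) ->
  (forall p, p < B -> eval rho (fmap (inst 0 (n + q + p)) (input_form None))) ->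
  exists2 u : seq bool, size u <= q & forall p a, p < q + B ->
    rho (xinput a, 0, n + p) = (a == nth None (map Some (map emb (map inr u))) p).
Proof.
elim: q n => [|q IH] n Hg Hn.
  exists [::] => // p a pB; rewrite nth_nil.
  by have /eval_input_form := Hn p pB; rewrite addn0.
have /eval_guess_form := Hg 0 isT; rewrite addn0 => -[[b nb]|[nN nS]].
  have [||u uq uP] := IH n.+1.
  - by move=> p pq; rewrite addSnnS; apply: Hg.
  - by move=> p pB; rewrite addSnnS; apply: Hn.
  exists (b :: u) => // -[|p] a; first by rewrite addn0 nb.
  by rewrite addSn ltnS addnS => /uP/=<-.
exists [::] => // p a pB; rewrite nth_nil.
suff: (forall a, rho (xinput a, 0, n + p) = (a == None)) by [].
(* The first guess is blank, and each blank guess forces the next one, so the certificate is empty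
   from here on. *)
have stop k : k <= q -> (forall a, rho (xinput a, 0, n + k) = (a == None)) /\
    rho (xinput None, 0, n + k.+1).
  elim: k => [|k IHk] kq; first by rewrite addn0 addn1.
  have [_ N] := IHk (ltnW kq).
  have /eval_guess_form := Hg k.+1 kq; case=> [[b nb]|]; first by rewrite nb in N.
  by rewrite [n + k.+2]addnS.
case: (leqP p q) => [/stop[]//|qp].
have /eval_input_form : eval rho (fmap (inst 0 (n + q.+1 + (p - q.+1))) (input_form None)).
  by apply: Hn; lia.
by have -> : n + q.+1 + (p - q.+1) = n + p by lia.
Qed.

Definition history (w : seq S) (u : seq bool) (x : atom) : bool :=
  let: (x, t, j) := x in
  let c := iter t next_config (@init M (input_word w u)) in
  match x with
  | inl (inl q) => q == conf_state c
  | inl (inr (d, i, a)) => a == side d (conf_tapes c i) j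
  | inr a => a == nth None (map Some (input_word w u)) j
  end.

(** A valuation yields a certificate through its guessed letters. [B < C] fixes the input at all
    positions up to [B], which the initial formulas read, and [T < B] keeps the shrinking window
    nonempty until time [T]. Conversely [history], which records the actual run at all times and
    indices, satisfies every instance. *)
Theorem tableauP w q T B C : T < B < C ->
  (exists rho, all (eval rho) (tableau w q T B C)) <->
  (exists2 u : seq bool, size u <= q &
     tm_accept (conf_state (run T (@init M (input_word w u))))).
Proof.
case/andP=> TB BC; have B0 : 0 < B by lia.
split=> [[rho]|[u uq acc]].
  rewrite /tableau !all_cat !all_map.
  case/and5P=> /allP Hw /allP Hg /allP Hn /allP Hi /andP[/all_allpairsP Hs Ha].
  have {}Hw p : p < size w -> forall a,
      rho (xinput a, 0, p) = (a == nth None (map Some (map emb (map inl w))) p).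
    move=> pw; apply/eval_input_form.
    case: w pw Hw {Hg Hn} => // x0 w0; set w := x0 :: w0 => pw Hw.
    have -> : nth None (map Some (map emb (map inl w))) p = Some (emb (inl (nth x0 w p))).
      by rewrite -!map_comp (nth_map x0).
    have := Hw (p, nth x0 w p); apply.
    have -> : (p, nth x0 w p) = nth (0, x0) (zip (iota 0 (size w)) w) p.
      by rewrite nth_zip ?size_iota // nth_iota.
    by rewrite mem_nth // size_zip size_iota minnn.
  have [||u uq uP] := @guess_word rho (size w) q C.
  - by move=> p pq; apply: Hg; rewrite mem_iota; lia.
  - by move=> p pB; apply: Hn; rewrite mem_iota; lia.
  exists u => //; rewrite run_next.
  have inP p a : p <= B ->
      rho (xinput a, 0, p) = (a == nth None (map Some (input_word w u)) p).
    move=> pB; rewrite /input_word map_cat map_cat nth_cat !size_map.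
    case: ltnP => [pw|wp]; first exact: (Hw p pw a).
    by rewrite -uP ?subnKC //; lia.
  have pin0 : pinned rho 0 B (@init M (input_word w u)).
    have E j : j < B ->
      [/\ forall q, rho (xstate q, 0, 0) = (q == tm_start M),
          forall i, pinned_cell rho 0 i (conf_tapes (@init M (input_word w u)) i) None 0 &
          forall i r, pinned_cell rho 0 i (conf_tapes (@init M (input_word w u)) i) (Some r) j].
      move=> jB; apply/(@eval_init_form rho j (input_word w u)).
        by move=> p a pj; apply: inP; lia.
      by apply: Hi; rewrite mem_iota; lia.
    by split=> [||i r j /E[]//]; case: (E 0 B0).
  have pinT t : t <= T -> pinned rho t (B - t) (iter t next_config (@init M (input_word w u))).
    elim: t => [|t IHt] tT; first by rewrite subn0.
    rewrite iterS; apply: pinned_step.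
    - lia.
    - by move=> j jB; apply: Hs; rewrite mem_iota; lia.
    - by rewrite (_ : (B - t.+1).+1 = B - t); [apply: IHt; lia|lia].
  by move: Ha; rewrite all_seq1 (eval_accept_form (pinT T (leqnn T))).
have pin t b : pinned (history w u) t b (iter t next_config (@init M (input_word w u))).
  by split.
exists (history w u); rewrite /tableau !all_cat !all_map; apply/and5P; split.
- apply/allP => -[p a] /(nthP (0, a))[j]; rewrite size_zip size_iota minnn => jw.
  rewrite nth_zip ?size_iota // nth_iota // => -[<- <-].
  apply/eval_input_form => b; rewrite /= /input_word map_cat map_cat nth_cat !size_map jw.
  by rewrite -!map_comp (nth_map a).
- apply/allP => p; rewrite mem_iota => /andP[wp pq]; apply/eval_guess_form.
  have E j : size w <= j -> nth None (map Some (input_word w u)) j =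
      nth None (map (fun b => Some (emb (inr b))) u) (j - size w).
    move=> wj; rewrite /input_word map_cat map_cat nth_cat !size_map ltnNge wj /=.
    by rewrite -!map_comp.
  rewrite /= !E //; last by lia.
  case: (ltnP (p - size w) (size u)) => pu.
    by left; exists (nth true u (p - size w)) => a; rewrite (nth_map true).
  right; split=> [a|]; first by rewrite nth_default // size_map.
  by rewrite nth_default // size_map; lia.
- apply/allP => p; rewrite mem_iota => /andP[wp pq]; apply/eval_input_form => a.
  by rewrite /= nth_default // /input_word !size_map size_cat !size_map; lia.
- by apply/allP => j _; apply/(@eval_init_form _ j (input_word w u)).
apply/andP; split; last by rewrite all_seq1 (eval_accept_form (pin T 0)) -run_next.
apply/all_allpairsP => t j _ _.
have [Rq Rh Rs] := pin t j.+2; have [Rq' Rh' Rs'] := pin t.+1 j.+2.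
apply/(@eval_step_form _ t j (iter t next_config (@init M (input_word w u)))) => //.
Qed.

End Tableau.


(** * Program combinators *)

Lemma nseq_cat_cons T k (x : T) s : nseq k x ++ x :: s = x :: nseq k x ++ s.
Proof. by elim: k => //= k ->. Qed.


Section Combinators.
Context (A : finType).
Implicit Types (c : cmd A) (s : store A) (n : nat).

Fixpoint rept k c : cmd A := if k is k'.+1 then Seq c (rept k' c) else Skip A.
Fixpoint nest d c : cmd A := if d is d'.+1 then Loop (nest d' c) else c.
(** The two parts realise the two summands of [poly_bound b d n]. The number of rounds is fixed, so
    a body that finishes sooner must idle afterwards. *)
Definition polyloop b d c : cmd A := Seq (rept b (nest d c)) (rept b c).

Lemma den_rept n k c s : den n (rept k c) s = iter k (den n c) s.
Proof. by elim: k s => //= k IH s; rewrite IH -iterSr. Qed.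

Lemma den_seq n c1 c2 s : den n (Seq c1 c2) s = den n c2 (den n c1 s).
Proof. by []. Qed.

Lemma den_polyloop n b d c s :
  den n (polyloop b d c) s = iter (poly_bound b d n) (den n c) s.
Proof.
have E s' : den n (nest d c) s' = iter (n ^ d) (den n c) s'.
  elim: d s' => [|d IH] s' //=.
  by rewrite expnS iterM; apply: eq_iter.
rewrite /= !den_rept /poly_bound addnC iterD iterM; congr iter.
exact: eq_iter.
Qed.

End Combinators.

(** * Unambiguity of the Polish notation *)

(** What may follow a term: the arity and name of a relation symbol have no terminator and could
    absorb a tick or a bit. *)
Definition starts_term (w : seq letter) : bool :=
  if w is (LTick | LBit _) :: _ then false else true.

Lemma nseq_cat_inj (T : eqType) (x : T) k k' u u' :
  ohead u != Some x -> ohead u' != Some x ->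
  nseq k x ++ u = nseq k' x ++ u' -> k = k' /\ u = u'.
Proof.
move=> hu hu'; elim: k k' => [|k IH] [|k'] //=.
- by move=> E; move: hu; rewrite E /= eqxx.
- by move=> E; move: hu'; rewrite -E /= eqxx.
- by case=> /IH[-> ->].
Qed.

Lemma map_bit_inj x x' u u' : starts_term u -> starts_term u' ->
  map LBit x ++ u = map LBit x' ++ u' -> x = x' /\ u = u'.
Proof.
move=> hu hu'; elim: x x' => [|b x IH] [|b' x'] //=.
- by move=> E; move: hu; rewrite E.
- by move=> E; move: hu'; rewrite -E.
- by case=> -> /IH[-> ->].
Qed.

(** The suffixes carry the induction through [J], where the first argument is followed by the
    second. *)
Lemma encode_cat_inj T T' u u' : starts_term u -> starts_term u' ->
  encode T ++ u = encode T' ++ u' -> T = T' /\ u = u'.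
Proof.
elim: T T' u u' => [k x||T IH|T IH|T IH|T IH|T1 IH1 T2 IH2]
  [k' x'||T'|T'|T'|T'|T1' T2'] u u' hu hu' //=; last first.
- case; rewrite -!catA => /IH1[||-> /(IH2 _ _ _ hu hu')[-> ->]] //.
    by case: (T2).
  by case: (T2').
- by case=> /(IH _ _ _ hu hu')[-> ->].
- by case=> /(IH _ _ _ hu hu')[-> ->].
- by case=> /(IH _ _ _ hu hu')[-> ->].
- by case=> /(IH _ _ _ hu hu')[-> ->].
- by case=> ->.
case; rewrite -!catA => /nseq_cat_inj[||-> /(map_bit_inj hu hu')[-> ->]] //.
  by case: x => //; case: u hu => // -[].
by case: x' => //; case: u' hu' => // -[].
Qed.

Lemma encode_inj : injective encode.
Proof.
by move=> T T' E; have [] := @encode_cat_inj T T' [::] [::] isT isT; rewrite ?cats0.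
Qed.

(** * The reduction *)

Section Reduction.
Context (S : finType) (M : tm) (emb : S + bool -> tm_alphabet M).
Notation X := (quantity M).

(** Times and indices stay in unary, as the program holds them, so that it can copy them into names
    letter by letter. *)
Definition name (v : atom M) : seq bool :=
  let: (x, t, j) := v in
  nseq t true ++ false :: nseq j true ++ false :: nseq (enum_rank x) true.

Lemma name_inj : injective name.
Proof.
case=> [[x t] j] [[x' t'] j'].
by do 2 (case/nseq_cat_inj=> // -> []); move/(congr1 size);
  rewrite !size_nseq => /val_inj/enum_rank_inj->.
Qed.

Definition bigand (Fs : seq (form (atom M))) := foldr (@And _) (Tru _) Fs.

Lemma eval_bigand rho Fs : eval rho (bigand Fs) = all (eval rho) Fs.
Proof. by elim: Fs => //= f Fs ->. Qed.

(* Register [0] is the output, [1] the input, [2] is auxiliary, and [3], [4]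
   hold the current time and index in unary. *)
Notation A := (S + letter)%type.
Notation prog := (cmd A).
Notation tick := (inr LTick : A).

(* Bound for the numbers held in registers. *)
Context (b d : nat).
Notation bound n := (poly_bound b d n).

Definition emit (l : letter) : prog := Push 0 (inr l : A).
Definition emits (w : seq letter) : prog :=
  foldr (fun l c => Seq c (emit l)) (Skip A) w.

Definition moves r r' (c : prog) : prog :=
  Case r (fun o : option A => if o is Some a then Seq (Pop A r) (Seq (Push r' a) c) else Skip A).

Definition emit_unary r : prog :=
  Seq (polyloop b d (moves r 2 (emit (LBit true)))) (polyloop b d (moves 2 r (Skip A))).

(** The output register is a stack, so everything is printed from its last letter to its first: the
    rank of the quantity before the index, the index before the time, an operator after its
    arguments. *)
Fixpoint print (f : form (tatom M)) : prog :=
  match f with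
  | Tru => emits (encode (term_of name (Tru _)))
  | Atom (x, dt, dj) =>
      Seq (emits (map LBit (false :: nseq (enum_rank x) true)))
      (Seq (if dj is Some c then
              Seq (if c then emit (LBit true) else Skip A) (emit_unary 4)
            else Skip A)
      (Seq (emit (LBit false))
      (Seq (if dt then emit (LBit true) else Skip A)
      (Seq (emit_unary 3) (emit LRel)))))
  | Not f => Seq (print f) (emit LNeg)
  | And f g => Seq (print g) (Seq (print f) (emit LJ))
  end.

Definition st5 (o w : seq A) m t j : store A :=
  [:: o; w; nseq m tick; nseq t tick; nseq j tick].

Lemma den_emits n w o i m t j :
  den n (emits w) (st5 o i m t j) = st5 (map inr w ++ o) i m t j.
Proof. by elim: w => //= l w ->. Qed.

Lemma den_emit_unary4 n o w t j : j <= bound n ->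
  den n (emit_unary 4) (st5 o w 0 t j) = st5 (nseq j (inr (LBit true)) ++ o) w 0 t j.
Proof.
have down k m o' i : i <= k -> iter k (den n (moves 4 2 (emit (LBit true)))) (st5 o' w m t i)
    = st5 (nseq i (inr (LBit true)) ++ o') w (m + i) t 0.
  elim: k m o' i => [|k IH] m o' [|i] // ik; rewrite ?addn0 // iterSr.
    by rewrite [den _ _ _]/= IH // addn0.
  rewrite [den _ _ _]/= (IH m.+1 (inr (LBit true) :: o') i) // addSnnS.
  by rewrite nseq_cat_cons.
have up k m o' i : m <= k -> iter k (den n (moves 2 4 (Skip A))) (st5 o' w m t i)
    = st5 o' w 0 t (m + i).
  elim: k m i => [|k IH] [|m] i // ik; rewrite iterSr.
    by rewrite [den _ _ _]/= IH.
  by rewrite [den _ _ _]/= (IH m i.+1) // addSnnS.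
by move=> jb; rewrite /emit_unary den_seq !den_polyloop down // up // addn0.
Qed.

Lemma den_emit_unary3 n o w t j : t <= bound n ->
  den n (emit_unary 3) (st5 o w 0 t j) = st5 (nseq t (inr (LBit true)) ++ o) w 0 t j.
Proof.
have down k m o' i : i <= k -> iter k (den n (moves 3 2 (emit (LBit true)))) (st5 o' w m i j)
    = st5 (nseq i (inr (LBit true)) ++ o') w (m + i) 0 j.
  elim: k m o' i => [|k IH] m o' [|i] // ik; rewrite ?addn0 // iterSr.
    by rewrite [den _ _ _]/= IH // addn0.
  rewrite [den _ _ _]/= (IH m.+1 (inr (LBit true) :: o') i) // addSnnS.
  by rewrite nseq_cat_cons.
have up k m o' i : m <= k -> iter k (den n (moves 2 3 (Skip A))) (st5 o' w m i j)
    = st5 o' w 0 (m + i) j.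
  elim: k m i => [|k IH] [|m] i // ik; rewrite iterSr.
    by rewrite [den _ _ _]/= IH.
  by rewrite [den _ _ _]/= (IH m i.+1) // addSnnS.
by move=> tb; rewrite /emit_unary den_seq !den_polyloop down // up // addn0.
Qed.

Notation atoms Fs := (map inr (encode (term_of name (bigand Fs))) : seq A).

Lemma den_print n f o w t j : t <= bound n -> j <= bound n ->
  den n (print f) (st5 o w 0 t j) =
  st5 (map inr (encode (term_of name (fmap (inst t j) f))) ++ o) w 0 t j.
Proof.
move=> tb jb; elim: f o => [|[[x dt] dj]|f IH|f IHf g IHg] o.
- exact: den_emits.
- rewrite /print; do 5!rewrite den_seq; rewrite den_emits.
  have -> : den n (if dj is Some c then
      Seq (if c then emit (LBit true) else Skip A) (emit_unary 4) else Skip A)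
      (st5 (map inr (map LBit (false :: nseq (enum_rank x) true)) ++ o) w 0 t j) =
    st5 (nseq (index_of j dj) (inr (LBit true)) ++
      map inr (map LBit (false :: nseq (enum_rank x) true)) ++ o) w 0 t j.
    case: dj => [[]|] //; rewrite den_seq.
    + have -> o' : den n (emit (LBit true)) (st5 o' w 0 t j) =
        st5 (inr (LBit true) :: o') w 0 t j by [].
      by rewrite den_emit_unary4 // nseq_cat_cons.
    + exact: den_emit_unary4.
  set o1 := _ ++ _.
  have -> : den n (if dt then emit (LBit true) else Skip A)
      (den n (emit (LBit false)) (st5 o1 w 0 t j)) =
      st5 (nseq dt (inr (LBit true)) ++ inr (LBit false) :: o1) w 0 t j by case: dt.
  rewrite den_emit_unary3 // [den _ (emit _) _]/= /o1; congr (_ :: _).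
  rewrite /= !map_cat /= !map_cat /= !map_nseq.
  congr (_ :: _); rewrite -catA /= -catA.
  by case: dt => //=; rewrite nseq_cat_cons.
- by rewrite /print -/print den_seq IH.
- rewrite /print -/print !den_seq IHg IHf.
  by rewrite catA -map_cat.
Qed.

Definition print_and f : prog := Seq (print f) (emit LJ).

Definition stf Fs w t j : store A := st5 (atoms Fs) w 0 t j.

Lemma den_print_and n f Fs w t j : t <= bound n -> j <= bound n ->
  den n (print_and f) (stf Fs w t j) = stf (fmap (inst t j) f :: Fs) w t j.
Proof.
move=> tb jb; rewrite /print_and den_seq den_print //.
by rewrite /stf /= map_cat.
Qed.

Definition next_index (f : form (tatom M)) : prog := Seq (print_and f) (Push 4 tick).

Lemma den_next_index n f Fs w t j : t <= bound n -> j <= bound n ->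
  den n (next_index f) (stf Fs w t j) = stf (fmap (inst t j) f :: Fs) w t j.+1.
Proof. by move=> tb jb; rewrite /next_index den_seq den_print_and. Qed.

Lemma iter_next_index n f Fs w t j k : t <= bound n -> j + k <= bound n ->
  iter k (den n (next_index f)) (stf Fs w t j) =
  stf (rev [seq fmap (inst t p) f | p <- iota j k] ++ Fs) w t (j + k).
Proof.
move=> tb; elim: k j Fs => [|k IH] j Fs jk; first by rewrite addn0.
rewrite iterSr den_next_index ?IH //; [|lia|lia].
by rewrite addSnnS /= rev_cons cat_rcons.
Qed.

Definition clear_index : prog := polyloop b d (Pop A 4).

Lemma den_clear_index n Fs w t j : j <= bound n ->
  den n clear_index (stf Fs w t j) = stf Fs w t 0.
Proof.
rewrite den_polyloop; elim: (bound n) j => [|k IH] [|j] // jk; rewrite iterSr.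
  exact: (IH 0).
exact: (IH j).
Qed.

Context (bq dq bT dT : nat).
Notation q n := (poly_bound bq dq n).
Notation T n := (poly_bound bT dT n).
Notation B n := (poly_bound bT.+1 dT n).
Notation C n := (poly_bound bT.+2 dT n).

Definition letter_form (x : S) := input_form (M := M) (Some (emb (inl x))).

Definition transfer r r' : prog := Loop (moves r r' (Skip A)).

(** Passing through register 2 keeps the input in order while register 0 becomes free for output.
    The innermost formula of the conjunction is printed at the start, and each further one is put in
    front. The index runs on through letters, guesses and blanks, whose positions are consecutive,
    and is reset for the later blocks. *)
Definition reduction : prog :=
  Seq (transfer 0 2) (Seq (transfer 2 1) (Seq (emits (encode (term_of name (Tru _))))
  (Seq (Loop (Case 1 (fun o : option A => if o is Some (inl x)
                then Seq (Pop A 1) (next_index (letter_form x)) else Skip A)))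
  (Seq (polyloop bq dq (next_index (guess_form emb)))
  (Seq (polyloop bT.+2 dT (next_index (input_form None)))
  (Seq clear_index
  (Seq (polyloop bT.+1 dT (next_index (init_form M)))
  (Seq clear_index
  (Seq (polyloop bT dT (Seq (polyloop bT.+1 dT (next_index (step_form M)))
                            (Seq clear_index (Push 3 tick))))
       (print_and (accept_form M))))))))))).

Lemma den_reduction (w : seq S) (n := size w) : n + q n + C n <= bound n ->
  den n reduction (map inl w :: nseq 4 [::]) =
  stf (rev (tableau emb w (q n) (T n) (B n) (C n))) [::] (T n) 0.
Proof.
move=> nb.
have BC : T n <= B n <= C n by rewrite /poly_bound; nia.
have t02 k (v u : seq A) : size v <= k -> iter k (den n (moves 0 2 (Skip A))) [:: v; [::]; u; [::]; [::]]
    = [:: [::]; [::]; rev v ++ u; [::]; [::]].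
  elim: k v u => [|k IH] [|x v] u // vk; rewrite iterSr [den _ _ _]/= IH //.
  by rewrite rev_cons cat_rcons.
have t21 k (v u : seq A) : size v <= k -> iter k (den n (moves 2 1 (Skip A))) [:: [::]; u; v; [::]; [::]]
    = [:: [::]; rev v ++ u; [::]; [::]; [::]].
  elim: k v u => [|k IH] [|x v] u // vk; rewrite iterSr [den _ _ _]/= IH //.
  by rewrite rev_cons cat_rcons.
rewrite /reduction [nseq _ _]/= den_seq [den _ (transfer _ _) _]/= t02 ?size_map // cats0.
rewrite den_seq [den _ (transfer _ _) _]/= t21 ?size_rev ?size_map // revK cats0.
rewrite -[[:: _; _; _; _; _]]/(st5 [::] (map inl w) 0 0 0) den_seq den_emits cats0.
rewrite -/(stf [::] (map inl w) 0 0) den_seq.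
have -> : den n (Loop (Case 1 (fun o : option A => if o is Some (inl x)
                then Seq (Pop A 1) (next_index (letter_form x)) else Skip A)))
     (stf [::] (map inl w) 0 0) =
   stf (rev [seq fmap (inst 0 p.1) (letter_form p.2) | p <- zip (iota 0 n) w]) [::] 0 n.
  rewrite [LHS]/=.
  have E (v : seq S) k Fs : k + size v <= n ->
    iter (size v) (den n (Case 1 (fun o : option A => if o is Some (inl x)
                then Seq (Pop A 1) (next_index (letter_form x)) else Skip A)))
     (stf Fs (map inl v) 0 k) =
     stf (rev [seq fmap (inst 0 p.1) (letter_form p.2) | p <- zip (iota k (size v)) v] ++ Fs)
      [::] 0 (k + size v).
    elim: v k Fs => [|x v IH] k Fs kn; first by rewrite addn0.
    rewrite [size _]/= iterSr.
    have -> : den n (Case 1 (fun o : option A => if o is Some (inl x)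
                then Seq (Pop A 1) (next_index (letter_form x)) else Skip A))
       (stf Fs (map inl (x :: v)) 0 k) =
        den n (next_index (letter_form x)) (stf Fs (map inl v) 0 k) by [].
    rewrite /= in kn; rewrite den_next_index ?IH //; [|lia|lia].
    by rewrite /= addnS rev_cons cat_rcons.
  by rewrite (E w 0 [::]) // cats0.
rewrite den_seq den_polyloop iter_next_index; [|lia|lia].
rewrite den_seq den_polyloop iter_next_index; [|lia|lia].
rewrite den_seq den_clear_index; last lia.
rewrite den_seq den_polyloop iter_next_index; [|lia|lia].
rewrite den_seq den_clear_index; last lia.
rewrite den_seq den_polyloop.
have E t k Fs : t + k <= bound n ->
  iter k (den n (Seq (polyloop bT.+1 dT (next_index (step_form M)))
                            (Seq clear_index (Push 3 tick)))) (stf Fs [::] t 0) =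
  stf (rev [seq fmap (inst t j) (step_form M) | t <- iota t k, j <- iota 0 (B n)] ++ Fs) [::] (t + k) 0.
  elim: k t Fs => [|k IH] t Fs tk; first by rewrite addn0.
  rewrite iterSr den_seq den_polyloop iter_next_index; [|lia|lia].
  rewrite den_seq den_clear_index; last lia.
  rewrite -[den _ (Push _ _) _]/(stf _ [::] t.+1 0) IH; last lia.
  by rewrite [iota t k.+1]/= allpairs_cons rev_cat addSnnS catA.
rewrite E; last lia.
rewrite den_print_and; [|lia|lia].
by rewrite add0n /tableau !rev_cat -!catA.
Qed.

End Reduction.

Theorem GRA_sat_NP_hard : NP_hard GRA_sat.
Proof.
move=> S L [V [bq [dq [[M [emb [bM [dM [emb_inj MP]]]]] LP]]]].
(* A time bound for the verifier on the word together with any admissible certificate, in terms of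
   the word alone. *)
have [bT [dT TP]] := polybP (polyb_poly_bound bM dM
  (polyb_add polyb_id (polyb_poly_bound bq dq polyb_id))).
(* This bounds every time and index that the reduction keeps in a register. *)
have [b [d bP]] := polybP (polyb_add
  (polyb_add polyb_id (polyb_poly_bound bq dq polyb_id))
  (polyb_poly_bound bT.+2 dT polyb_id)).
pose F (w : seq S) := let n := size w in bigand (rev (tableau emb w
  (poly_bound bq dq n) (poly_bound bT dT n) (poly_bound bT.+1 dT n) (poly_bound bT.+2 dT n))).
exists (fun w => encode (term_of (@name M) (F w))); split.
  have [M' [i [b' [d' [i_inj M'P]]]]] := program_machine (reduction emb b d bq dq bT dT) 4.
  exists M', (i \o inl), (i \o inr), b', d'.
  split; first by move=> x y /i_inj[].
  split; first by move=> x y /i_inj[].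
  move=> w; case: (M'P (map inl w)) => H W _; move: H W.
  rewrite size_map -map_comp den_reduction ?bP // => H W; split=> //.
  by rewrite W -map_comp.
move=> w; have -> : GRA_sat (encode (term_of (@name M) (F w))) <->
    satisfiable (term_of (@name M) (F w)).
  by split=> [[T /encode_inj ->]|sat] //; exists (term_of (@name M) (F w)).
rewrite satisfiable_term_of; last exact: name_inj.
have -> : (exists rho, eval rho (F w)) <-> (exists rho, all (eval rho) (tableau emb w
  (poly_bound bq dq (size w)) (poly_bound bT dT (size w))
  (poly_bound bT.+1 dT (size w)) (poly_bound bT.+2 dT (size w)))).
  by split=> -[rho rhoF]; exists rho; move: rhoF; rewrite /F eval_bigand all_rev.
(* Raising the coefficient of [poly_bound] by one also raises its constant term, so the three bounds
   increase strictly, even for the empty word. *)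
rewrite tableauP; last by rewrite /poly_bound; nia.
rewrite LP.
have E u : size u <= poly_bound bq dq (size w) ->
  V (map inl w ++ map inr u) <->
  tm_accept (conf_state (run (poly_bound bT dT (size w)) (init (input_word emb w u)))).
  (* The verifier halts within its bound for the actual length, and idling up to the common time
     changes nothing. *)
  move=> uq; have [H <-] := MP (map inl w ++ map inr u).
  rewrite (run_halted _ H) //; apply: leq_trans (TP (size w)).
  by apply: leq_poly_bound; rewrite size_cat !size_map leq_add2l.
by split=> -[u uq /(E u uq)]; exists u.
Qed.


(** * The certificate checker *)

Arguments den : simpl never.

Notation symb := (letter + bool)%type.
Notation prog := (cmd (letter + bool)%type).
Notation skip := (Skip (letter + bool)%type).
Notation pop := (Pop (letter + bool)%type).

(* All registers will hold at most three letters per input letter. *)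
Definition loop3 (c : prog) : prog := Loop (Seq c (Seq c c)).

Lemma den_loop3 n c s : den n (loop3 c) s = iter (3 * n) (den n c) s.
Proof. by rewrite mulnC iterM; apply: eq_iter. Qed.

Lemma den_push n r a (s : store symb) : den n (Push r a) s = upd s r (a :: get s r).
Proof. by []. Qed.

Lemma den_pop n r (s : store symb) : den n (pop r) s = upd s r (behead (get s r)).
Proof. by []. Qed.

Lemma den_case n r f (s : store symb) : den n (Case r f) s = den n (f (ohead (get s r))) s.
Proof. by []. Qed.

Lemma den_skip n (s : store symb) : den n skip s = s.
Proof. by []. Qed.

Definition move_while (p : pred symb) x y : prog :=
  loop3 (Case x (fun o : option symb => if o is Some a then
    if p a then Seq (pop x) (Push y a) else skip else skip)).

Definition stops (p : pred symb) (v : seq symb) := if v is a :: _ then ~~ p a else true.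

Lemma upd_get (s : store symb) x : x < size s -> upd s x (get s x) = s.
Proof.
move=> xs; apply: (@eq_from_nth _ [::]); first by rewrite size_set_nth (maxn_idPr xs).
by move=> i _; rewrite nth_set_nth /=; case: eqP => [->|].
Qed.

Lemma size_upd (s : store symb) x v : x < size s -> size (upd s x v) = size s.
Proof. by move=> xs; rewrite size_set_nth (maxn_idPr xs). Qed.

Lemma updC (s : store symb) x y u v : x != y -> upd (upd s x u) y v = upd (upd s y v) x u.
Proof. by move=> xy; rewrite /upd set_set_nth (negPf xy). Qed.

Lemma updK (s : store symb) x u v : upd (upd s x u) x v = upd s x v.
Proof. by rewrite /upd set_set_nth eqxx. Qed.

Lemma den_move_while n p x y u v (s : store symb) :
  get s x = u ++ v -> x != y -> x < size s -> y < size s ->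
  all p u -> stops p v -> size u <= 3 * n ->
  den n (move_while p x y) s = upd (upd s x v) y (rev u ++ get s y).
Proof.
rewrite den_loop3; set f := den n _; move: (3 * n) => k.
have stay s' : stops p (get s' x) -> f s' = s'.
  by rewrite /f den_case; case: (get s' x) => //= a l /negPf ->.
have go s' a l : get s' x = a :: l -> p a -> f s' = upd (upd s' x l) y (a :: get (upd s' x l) y).
  by move=> sx pa; rewrite /f den_case sx /= pa den_seq den_push den_pop sx.
move=> sx xy xs ys; elim: k u s sx xs ys => [|k IH] [|a u] s sx xs ys //=.
- by move=> _ _ _; rewrite -[v]sx !upd_get // size_upd.
- move=> _ pv _; rewrite -/(iter k.+1 _ s) iter_fix; last by apply: stay; rewrite sx.
  by rewrite -[v]sx !upd_get.
case/andP=> pa pu pv uk; rewrite -/(iter k.+1 _ s) iterSr (go _ _ _ sx pa).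
have yx : (y == x) = false by rewrite eq_sym (negPf xy).
rewrite (IH u); rewrite ?size_upd ?get_upd ?eqxx ?yx ?(negPf xy) //.
by rewrite rev_cons cat_rcons [upd (upd (upd s x _) y _) x _]updC ?yx // !updK.
Qed.

Definition clear x : prog := loop3 (pop x).

Lemma den_clear n x (s : store symb) : x < size s -> size (get s x) <= 3 * n ->
  den n (clear x) s = upd s x [::].
Proof.
rewrite den_loop3; elim: (3 * n) s => [|k IH] s xs.
  by rewrite leqn0 => /eqP/size0nil/= sx; rewrite -sx upd_get.
move=> sk; rewrite iterSr den_pop IH; rewrite ?get_upd ?eqxx ?size_upd ?updK //.
by rewrite size_behead; lia.
Qed.

(** * Tuples as words: entries in unary *)

Definition ent i : seq symb := rcons (nseq i (inr true)) (inr false).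
Definition ents (r : seq nat) : seq symb := flatten (map ent r).
Definition is_one (a : symb) : bool := a == inr true.
Definition is_bit (a : symb) : bool := if a is inr _ then true else false.

(** The terminator is pushed before the ones, so the entry arrives in its own order and not
    reversed. *)
Definition move_entry x y : prog :=
  Seq (Push y (inr false : symb)) (Seq (move_while is_one x y) (pop x)).

Lemma den_move_entry n x y i v (s : store symb) :
  get s x = nseq i (inr true) ++ v -> x != y -> x < size s -> y < size s ->
  stops is_one v -> i <= 3 * n ->
  den n (move_entry x y) s = upd (upd s x (behead v)) y (ent i ++ get s y).
Proof.
move=> sx xy xs ys vP ik; have yx : (y == x) = false by rewrite eq_sym (negPf xy).
rewrite /move_entry !den_seq den_push (@den_move_while n is_one x y (nseq i (inr true)) v) //.
- rewrite den_pop !get_upd eqxx (negPf xy) eqxx.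
  rewrite [upd (upd (upd _ _ _) _ _) y _]updC ?xy // updK.
  by rewrite updK updC ?yx // rev_nseq /ent cat_rcons.
- by rewrite get_upd (negPf xy).
- by rewrite size_upd.
- by rewrite size_upd.
- by rewrite all_nseq orbT.
- by rewrite size_nseq.
Qed.

Lemma den_move_ent n x y i v (s : store symb) :
  get s x = ent i ++ v -> x != y -> x < size s -> y < size s -> i <= 3 * n ->
  den n (move_entry x y) s = upd (upd s x v) y (ent i ++ get s y).
Proof.
rewrite /ent cat_rcons => sx xy xs ys ik.
by rewrite (@den_move_entry n x y i (inr false :: v)).
Qed.

Lemma den_move_ent1 n x y i (s : store symb) :
  get s x = ent i -> x != y -> x < size s -> y < size s -> i <= 3 * n ->
  den n (move_entry x y) s = upd (upd s x [::]) y (ent i ++ get s y).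
Proof. by move=> sx *; apply: den_move_ent => //; rewrite cats0. Qed.

(* An unterminated entry is read up to the end of the certificate. *)
Definition read_val (u : seq bool) : nat := index false u.
Definition read_rest (u : seq bool) : seq bool := drop (index false u).+1 u.

Lemma den_read_entry n x y u (s : store symb) :
  get s x = map inr u -> x != y -> x < size s -> y < size s -> size u <= 3 * n ->
  den n (move_entry x y) s = upd (upd s x (map inr (read_rest u))) y (ent (read_val u) ++ get s y).
Proof.
move=> sx xy xs ys uk.
have uE : u = nseq (read_val u) true ++ drop (read_val u) u.
  by rewrite /read_val; elim: u {sx uk} => [|[] u IH] //=; rewrite {1}IH.
have hd : if drop (read_val u) u is b :: _ then ~~ b else true.
  by rewrite /read_val; elim: u {sx uk uE} => [|[] u IH].
rewrite (@den_move_entry n x y (read_val u) (map inr (drop (read_val u) u))) //.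
- rewrite /read_rest /read_val; congr (upd (upd _ _ _) _ _).
  by rewrite behead_map -drop1 drop_drop add1n.
- by rewrite sx {1}uE map_cat map_nseq.
- by case: (drop _ _) hd => [|[]].
- by apply: leq_trans uk; apply: index_size.
Qed.

Lemma ents_cons i r : ents (i :: r) = ent i ++ ents r. Proof. by []. Qed.
Lemma ents_cat r1 r2 : ents (r1 ++ r2) = ents r1 ++ ents r2.
Proof. by rewrite /ents map_cat flatten_cat. Qed.

Lemma size_ent i : size (ent i) = i.+1.
Proof. by rewrite size_rcons size_nseq. Qed.

Lemma ents_bits r : all is_bit (ents r).
Proof. by elim: r => // i r IH; rewrite ents_cons all_cat IH all_rcons all_nseq orbT. Qed.

Definition case_entry x (c1 c2 : prog) : prog :=
  Case x (fun o : option symb => if o is Some (inr _) then c1 else c2).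

Lemma den_case_entry n x c1 c2 r v (s : store symb) :
  get s x = ents r ++ v -> stops is_bit v ->
  den n (case_entry x c1 c2) s = den n (if r is [::] then c2 else c1) s.
Proof.
move=> sx vP; rewrite den_case sx; case: r {sx} => [|[|i] r] //=.
by case: v vP => [|[] v].
Qed.

(** The letters of a term are read from right to left. Register [0] holds what
    is left of the certificate, [1] the letters still to be read, [2] a stack of
    tuples with the truth values that the corresponding terms take there, [3] the
    arguments and the name of the relation symbol being read, [4] the list of
    the atoms met so far, and [5] is nonempty once the check has failed. Tuples
    are stored with their last entry on top. *)
Definition regs u w s k l f a b c d e : store symb := [:: u; w; s; k; l; f; a; b; c; d; e].

Definition sep v : symb := inl (LBit v).
(** These letters never occur in a key, where [LBit] spells the name, so a verdict marks the end of
    a record. *)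
Definition verdict (v : bool) : symb := inl (if v then LP else LS).
Definition mark : symb := inr true.
Definition fail : prog := Push 5 mark.

Definition match_step : prog :=
  Case 6 (fun o : option symb => if o is Some a then
    Case 7 (fun o' : option symb => if o' is Some b then
      if a == b then Seq (pop 6) (Seq (pop 7) (Push 8 a)) else skip
    else skip) else skip).

Definition restore_step : prog :=
  Case 8 (fun o : option symb => if o is Some a then
    Seq (pop 8) (Seq (Push 6 a) (Push 7 a)) else skip).

(* Registers [6] and [7] keep their contents; [9] becomes nonempty when they
   differ. *)
Definition compare : prog :=
  Seq (loop3 match_step)
  (Seq (Case 6 (fun o : option symb => if o is Some _ then Push 9 mark else
         Case 7 (fun o' : option symb => if o' is Some _ then Push 9 mark else skip)))
       (loop3 restore_step)).

Lemma iter_match_step n u w s k l f e m a b c : size a <= m ->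
  exists p a' b', [/\ a = p ++ a', b = p ++ b', (a == b) = nilp a' && nilp b' &
    iter m (den n match_step) (regs u w s k l f a b c [::] e) =
    regs u w s k l f a' b' (rev p ++ c) [::] e].
Proof.
elim: m a b c => [|m IH] [|x a] b c // am.
- by exists [::], [::], b; split=> //; case: b.
- by exists [::], [::], b; split=> //; [case: b|rewrite iter_fix].
- case: b => [|y b]; first by exists [::], (x :: a), [::]; split=> //; rewrite iter_fix.
  case: (eqVneq x y) => [<-|xy].
    have [p [a' [b' [-> -> ab R]]]] := IH a b (x :: c) am.
    exists (x :: p), a', b'; split=> //.
      by rewrite -ab eqseq_cons eqxx eqseq_cat // eqxx.
    rewrite iterSr /match_step !den_case /= eqxx.
    by rewrite rev_cons cat_rcons -R.
  exists [::], (x :: a), (y :: b); split=> //.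
    by rewrite eqseq_cons (negPf xy).
  by rewrite iter_fix // /match_step !den_case /= (negPf xy).
Qed.

Lemma iter_restore_step n u w s k l f d e m a b c : size c <= m ->
  iter m (den n restore_step) (regs u w s k l f a b c d e) =
  regs u w s k l f (rev c ++ a) (rev c ++ b) [::] d e.
Proof.
elim: m a b c => [|m IH] a b [|x c] // cm.
  by rewrite iter_fix.
rewrite iterSr [den _ _ _](_ : _ = regs u w s k l f (x :: a) (x :: b) c d e) //.
by rewrite IH // rev_cons !cat_rcons.
Qed.

Lemma den_compare n u w s k l f a b e : size a <= 3 * n ->
  den n compare (regs u w s k l f a b [::] [::] e) =
  regs u w s k l f a b [::] (if a == b then [::] else [:: mark]) e.
Proof.
move=> an; rewrite /compare !den_seq !den_loop3.
have [p [a' [b' [aE bE -> ->]]]] := iter_match_step n u w s k l f e b [::] an.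
rewrite cats0; set s1 := den _ _ _.
have -> : s1 = regs u w s k l f a' b' (rev p) (if nilp a' && nilp b' then [::] else [:: mark]) e.
  by rewrite /s1; case: (a') => [|? ?]; case: (b').
rewrite iter_restore_step; first by rewrite revK -aE -bE.
by rewrite size_rev; apply: leq_trans an; rewrite aE size_cat leq_addr.
Qed.

(** * Encoding of the stack and operations on its top *)

Definition encS (S : seq (seq nat * bool)) : seq symb :=
  flatten [seq sep p.2 :: ents p.1 | p <- S].

(** The arity of the symbol is present as the number of entries. *)
Definition key (r : seq nat) (x : seq bool) : seq symb := ents r ++ map (fun b => inl (LBit b)) x.

Definition record (p : bool * (seq nat * seq bool)) : seq symb :=
  rcons (key p.2.1 p.2.2) (verdict p.1).

Definition encL (L : seq (bool * (seq nat * seq bool))) : seq symb := flatten (map record L).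

Lemma encS_stops S : stops is_bit (encS S).
Proof. by case: S. Qed.

Definition swap : prog :=
  case_entry 2 (Seq (move_entry 2 6)
    (case_entry 2 (Seq (move_entry 2 7) (Seq (move_entry 6 2) (move_entry 7 2)))
                  (move_entry 6 2))) skip.

Definition swap_top T (r : seq T) := if r is a :: b :: r' then b :: a :: r' else r.

Section Operations.
Context (n : nat).

Lemma den_swap u w r S k l f : size (ents r) <= 3 * n ->
  den n swap (regs u w (ents r ++ encS S) k l f [::] [::] [::] [::] [::]) =
  regs u w (ents (swap_top r) ++ encS S) k l f [::] [::] [::] [::] [::].
Proof.
move=> rn; rewrite /swap (@den_case_entry _ _ _ _ r (encS S)) //; last exact: encS_stops.
case: r rn => [|a r] rn //; rewrite ents_cons -catA size_cat size_ent in rn *.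
rewrite den_seq (@den_move_ent _ 2 6 a (ents r ++ encS S)) //= ?cats0; last lia.
rewrite (@den_case_entry _ _ _ _ r (encS S)) //; last exact: encS_stops.
case: r rn => [|b r] rn.
  by rewrite (@den_move_ent1 _ 6 2 a) //= ?ents_cons ?cats0 //; lia.
rewrite ents_cons -catA size_cat size_ent in rn *.
rewrite den_seq (@den_move_ent _ 2 7 b (ents r ++ encS S)) //= ?cats0; last lia.
rewrite den_seq (@den_move_ent1 _ 6 2 a) //=; last lia.
rewrite (@den_move_ent1 _ 7 2 b) //=; last lia.
by rewrite !ents_cons -!catA.
Qed.


Lemma den_move_all x y u (s : store symb) :
  get s x = u -> x != y -> x < size s -> y < size s -> size u <= 3 * n ->
  den n (move_while predT x y) s = upd (upd s x [::]) y (rev u ++ get s y).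
Proof.
move=> sx xy xs ys un; apply: den_move_while => //; first by rewrite cats0.
exact: all_predT.
Qed.

Definition rotate : prog :=
  case_entry 2 (Seq (move_entry 2 6) (Seq (move_while is_bit 2 8)
    (Seq (move_entry 6 2) (move_while predT 8 2)))) skip.

Lemma den_rotate u w r S k l f : size (ents r) <= 3 * n ->
  den n rotate (regs u w (ents r ++ encS S) k l f [::] [::] [::] [::] [::]) =
  regs u w (ents (rot 1 r) ++ encS S) k l f [::] [::] [::] [::] [::].
Proof.
move=> rn; rewrite /rotate (@den_case_entry _ _ _ _ r (encS S)) //; last exact: encS_stops.
case: r rn => [|a r] rn //; rewrite ents_cons -catA size_cat size_ent in rn *.
rewrite den_seq (@den_move_ent _ 2 6 a (ents r ++ encS S)) //= ?cats0; last lia.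
rewrite den_seq (@den_move_while _ _ 2 8 (ents r) (encS S)) //=; last first.
- lia.
- exact: encS_stops.
- exact: ents_bits.
rewrite den_seq (@den_move_ent1 _ 6 2 a) //= ?cats0; last lia.
rewrite (@den_move_all 8 2 (rev (ents r))) //= ?size_rev; last lia.
by rewrite revK rot1_cons -cats1 ents_cat -catA /ents /= cats0.
Qed.

Definition merge : prog :=
  case_entry 2 (Seq (move_entry 2 6)
    (case_entry 2 (Seq (move_entry 2 7) (Seq compare
       (Seq (Case 9 (fun o : option symb => if o is Some _ then Seq (pop 9) fail else skip))
       (Seq (move_entry 6 2) (clear 7)))))
     (move_entry 6 2))) skip.

Definition merge_top T (r : seq T) := if r is a :: b :: r' then a :: r' else r.
Definition differ_top (r : seq nat) := if r is a :: b :: r' then a != b else false.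

Lemma ent_inj : injective ent.
Proof. by move=> i j /(congr1 size); rewrite !size_ent => -[]. Qed.

Lemma den_merge u w r S k l F : size (ents r) <= 3 * n ->
  den n merge (regs u w (ents r ++ encS S) k l (nseq F mark) [::] [::] [::] [::] [::]) =
  regs u w (ents (merge_top r) ++ encS S) k l (nseq (differ_top r + F) mark)
    [::] [::] [::] [::] [::].
Proof.
move=> rn; rewrite /merge (@den_case_entry _ _ _ _ r (encS S)) //; last exact: encS_stops.
case: r rn => [|a r] rn //; rewrite ents_cons -catA size_cat size_ent in rn *.
rewrite den_seq (@den_move_ent _ 2 6 a (ents r ++ encS S)) //= ?cats0; last lia.
rewrite (@den_case_entry _ _ _ _ r (encS S)) //; last exact: encS_stops.
case: r rn => [|b r] rn.
  by rewrite (@den_move_ent1 _ 6 2 a) //= ?ents_cons ?cats0 //; lia.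
rewrite ents_cons -catA size_cat size_ent in rn *.
rewrite den_seq (@den_move_ent _ 2 7 b (ents r ++ encS S)) //= ?cats0; last lia.
rewrite den_seq -/(regs _ _ _ _ _ _ _ _ _ _ _) den_compare ?size_ent; last lia.
rewrite (inj_eq ent_inj) den_seq.
set s1 := den n (Case 9 _) _.
have -> : s1 = regs u w (ents r ++ encS S) k l (nseq ((a != b) + F) mark)
    (ent a) (ent b) [::] [::] [::] by rewrite /s1; case: (a == b).
rewrite den_seq (@den_move_ent1 _ 6 2 a) //=; last lia.
rewrite den_clear //= ?size_ent; last lia.
by rewrite ents_cons -catA.
Qed.

(** Reading from right to left leaves the left argument of [J] on top of the stack. Tuples being
    reversed, its entries [r] end up below the entries [r'] of the right argument. *)
Definition join v : prog :=
  Seq (move_while is_bit 2 8) (Case 2 (fun o : option symb => if o is Some (inl (LBit v'))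
    then Seq (pop 2) (Seq (move_while is_bit 2 6) (Seq (move_while predT 8 2)
           (Seq (move_while predT 6 2) (Push 2 (sep (v && v'))))))
    else Seq (move_while predT 8 2) (Seq (Push 2 (sep v)) fail))).

Lemma den_join u w r v S k l F : size (ents r) + size (encS S) <= 3 * n ->
  den n (join v) (regs u w (ents r ++ encS S) k l (nseq F mark) [::] [::] [::] [::] [::]) =
  (if S is (r', v') :: S'
   then regs u w (encS ((r' ++ r, v && v') :: S')) k l (nseq F mark) [::] [::] [::] [::] [::]
   else regs u w (encS ((r, v) :: S)) k l (nseq F.+1 mark) [::] [::] [::] [::] [::]).
Proof.
move=> rn; rewrite /join den_seq (@den_move_while _ _ 2 8 (ents r) (encS S)) //=; last first.
- lia.
- exact: encS_stops.
- exact: ents_bits.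
rewrite cats0 den_case /=; case: S rn => [|[r' v'] S] rn.
  rewrite /= den_seq (@den_move_all 8 2 (rev (ents r))) //= ?size_rev; last lia.
  by rewrite revK den_seq !den_push.
rewrite /encS /= -/(encS S) size_cat in rn *.
rewrite den_seq den_pop /=.
rewrite den_seq (@den_move_while _ _ 2 6 (ents r') (encS S)) //=; last first.
- lia.
- exact: encS_stops.
- exact: ents_bits.
rewrite cats0 den_seq (@den_move_all 8 2 (rev (ents r))) //= ?size_rev; last lia.
rewrite den_seq (@den_move_all 6 2 (rev (ents r'))) //= ?size_rev; last lia.
by rewrite !revK den_push /= ents_cat -catA.
Qed.

Definition read_equality : prog :=
  Seq (move_entry 0 6) (Seq (move_entry 0 7) (Seq compare
    (Case 9 (fun o : option symb => Seq (pop 9) (Seq (move_entry 6 2) (Seq (move_entry 7 2)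
      (Push 2 (sep (if o is Some _ then false else true))))))))).

Lemma size_read u : read_val u + size (read_rest u) <= size u.
Proof.
have : read_val u <= size u by apply: index_size.
by rewrite /read_rest size_drop -/(read_val u); move: (read_val u) (size u); lia.
Qed.

Lemma den_read_equality U w S k l f : size U < 3 * n ->
  let i := read_val U in let j := read_val (read_rest U) in
  den n read_equality (regs (map inr U) w (encS S) k l f [::] [::] [::] [::] [::]) =
  regs (map inr (read_rest (read_rest U))) w (encS (([:: j; i], i == j) :: S)) k l f
    [::] [::] [::] [::] [::].
Proof.
move=> un i j; have := size_read U; have := size_read (read_rest U).
rewrite -/i -/j => le1 le2.
rewrite /read_equality den_seq (@den_read_entry _ 0 6 U) //= ?cats0; last lia.
rewrite den_seq (@den_read_entry _ 0 7 (read_rest U)) //= ?cats0; last lia.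
rewrite den_seq -/(regs _ _ _ _ _ _ _ _ _ _ _) den_compare ?size_ent; last lia.
rewrite (inj_eq ent_inj) den_case.
have -> : get (regs (map inr (read_rest (read_rest U))) w (encS S) k l f (ent i) (ent j) [::]
   (if i == j then [::] else [:: mark]) [::]) 9 = if i == j then [::] else [:: mark] by [].
rewrite den_seq den_pop.
set s1 := upd _ _ _.
have -> : s1 = regs (map inr (read_rest (read_rest U))) w (encS S) k l f (ent i) (ent j)
  [::] [::] [::] by rewrite /s1; case: (i == j).
rewrite den_seq (@den_move_ent1 _ 6 2 i) //=; last lia.
rewrite den_seq (@den_move_ent1 _ 7 2 j) //=; last lia.
rewrite den_push /= /encS /= -/(encS S) !ents_cons -!catA /=.
by case: (i == j).
Qed.

(** * The list of atoms *)

Definition is_verdict (a : symb) : bool := (a == verdict true) || (a == verdict false).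

(* Takes one record from register [x], runs [c] with that record in register
   [7], and puts it into register [y]. *)
Definition with_record x y c : prog :=
  Case x (fun o : option symb => if o is Some _ then
    Seq (move_while (predC is_verdict) x 7)
    (Seq (Case x (fun o' : option symb => if o' is Some a then Seq (pop x) (Push 7 a) else skip))
    (Seq c (move_while predT 7 y))) else skip).

Definition conflict_step : prog :=
  with_record 4 10 (Seq compare
    (Case 9 (fun o : option symb => if o is Some _ then pop 9 else fail))).

Definition return_step : prog := with_record 10 4 skip.

Lemma key_no_verdict r x : all (predC is_verdict) (key r x).
Proof.
rewrite /key all_cat; apply/andP; split; last by apply/allP => a /mapP[b _ ->]; case: b.
by apply: sub_all (ents_bits r) => -[].
Qed.

Lemma rev_record p : rev (record p) = verdict p.1 :: rev (key p.2.1 p.2.2).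
Proof. by rewrite rev_rcons. Qed.

Lemma ents_inj : injective ents.
Proof.
elim=> [|i r IH] [|i' r'] //.
- by move/(congr1 size); rewrite ents_cons size_cat size_ent.
- by move/(congr1 size); rewrite ents_cons size_cat size_ent.
- by rewrite !ents_cons /ent !cat_rcons => /nseq_cat_inj[] // -> [] /IH ->.
Qed.

Lemma record_inj : injective record.
Proof.
move=> [v [r x]] [v' [r' x']] /rcons_inj[/= E vv'].
have -> : v = v' by case: v v' vv' => -[].
have F r0 x0 : filter is_bit (key r0 x0) = ents r0.
  rewrite filter_cat (all_filterP (ents_bits r0)) -[RHS]cats0; congr cat.
  by elim: x0.
have /ents_inj rr' : ents r = ents r' by rewrite -(F r x) E F.
move: E; rewrite rr' /key => /eqP; rewrite eqseq_cat // eqxx => /eqP/inj_map-> //.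
by move=> ? ? [].
Qed.

(** Moving a record to register 7 reverses it, so it is compared with a reversed [p]; moving it on
    to register 10 restores its order. Every occurrence of [p] counts as a fault. *)
Lemma iter_conflict_step u w s k m L L' F p : size L <= m ->
  size (record p) <= 3 * n -> size (encL L) <= 3 * n ->
  iter m (den n conflict_step) (regs u w s k (encL L) (nseq F mark) (rev (record p))
    [::] [::] [::] (encL L')) =
  regs u w s k [::] (nseq (F + count_mem p L) mark) (rev (record p)) [::] [::] [::]
    (encL (rev L ++ L')).
Proof.
elim: m L L' F => [|m IH] [|q L] L' F // Lm pn Ln.
- by rewrite addn0.
- by rewrite iter_fix // addn0.
have EL : encL (q :: L) = record q ++ encL L by [].
rewrite EL size_cat in Ln *; rewrite iterSr.
set s1 := den _ _ _.
have -> : s1 = regs u w s k (encL L) (nseq (F + (q == p)) mark) (rev (record p))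
    [::] [::] [::] (encL (q :: L')).
  rewrite /s1 /conflict_step /with_record den_case /=.
  case: q Lm EL Ln {s1} => v [r x]; set q := (v, (r, x)) => Lm EL Ln.
  have -> : record q ++ encL L = key r x ++ verdict v :: encL L by rewrite /record cat_rcons.
  case hd : (ohead _) => [a|]; last by case: (key r x) hd.
  rewrite /record size_rcons /= in Ln.
  rewrite den_seq (@den_move_while _ _ 4 7 (key r x) (verdict v :: encL L)) //=; last first.
  + lia.
  + by case: (v).
  + exact: key_no_verdict.
  rewrite cats0 den_seq.
  set s2 := den n (Case 4 _) _.
  have -> : s2 = regs u w s k (encL L) (nseq F mark) (rev (record p))
      (verdict q.1 :: rev (key q.2.1 q.2.2)) [::] [::] (encL L') by [].
  rewrite -rev_record.
  rewrite den_seq den_seq den_compare ?size_rev //.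
  rewrite (inj_eq (can_inj revK)) (inj_eq record_inj) [p == q]eq_sym.
  set s3 := den n (Case 9 _) _.
  have -> : s3 = regs u w s k (encL L) (nseq (F + (q == p)) mark) (rev (record p))
      (rev (record q)) [::] [::] (encL L').
    by rewrite /s3; case: (q == p); rewrite ?addn0 // addn1.
  rewrite (@den_move_all 7 10 (rev (record q))) //= ?size_rev ?revK //.
  by rewrite /record size_rcons /=; lia.
rewrite IH //; last lia.
by rewrite -addnA rev_cons cat_rcons.
Qed.

Lemma iter_return_step u w s k m L L' f a : size L <= m -> size (encL L) <= 3 * n ->
  iter m (den n return_step) (regs u w s k (encL L') f a [::] [::] [::] (encL L)) =
  regs u w s k (encL (rev L ++ L')) f a [::] [::] [::] [::].
Proof.
elim: m L L' => [|m IH] [|q L] L' // Lm Ln; first by rewrite iter_fix.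
have EL : encL (q :: L) = record q ++ encL L by [].
rewrite EL size_cat in Ln *; rewrite iterSr.
set s1 := den _ _ _.
have -> : s1 = regs u w s k (encL (q :: L')) f a [::] [::] [::] (encL L).
  rewrite /s1 /return_step /with_record den_case /=.
  case: q Lm EL Ln {s1} => v [r x]; set q := (v, (r, x)) => Lm EL Ln.
  have -> : record q ++ encL L = key r x ++ verdict v :: encL L by rewrite /record cat_rcons.
  case hd : (ohead _) => [b|]; last by case: (key r x) hd.
  rewrite /record size_rcons /= in Ln.
  rewrite den_seq (@den_move_while _ _ 10 7 (key r x) (verdict v :: encL L)) //=; last first.
  + lia.
  + by case: (v).
  + exact: key_no_verdict.
  rewrite cats0 den_seq.
  set s2 := den n (Case 10 _) _.
  have -> : s2 = regs u w s k (encL L') f a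
      (verdict q.1 :: rev (key q.2.1 q.2.2)) [::] [::] (encL L) by [].
  rewrite -rev_record.
  rewrite den_seq den_skip (@den_move_all 7 4 (rev (record q))) //= ?size_rev ?revK //.
  by rewrite /record size_rcons /=; lia.
by rewrite IH //; [rewrite rev_cons cat_rcons|lia].
Qed.

Definition copy_step : prog :=
  Case 8 (fun o : option symb => if o is Some a then Seq (pop 8) (Seq (Push 2 a) (Push 3 a)) else skip).

Lemma iter_copy_step u w s k l f a b c d e m : size c <= m ->
  iter m (den n copy_step) (regs u w s k l f a b c d e) =
  regs u w (rev c ++ s) (rev c ++ k) l f a b [::] d e.
Proof.
elim: m s k c => [|m IH] s k [|x c] // cm; first by rewrite iter_fix.
rewrite iterSr [den _ _ _](_ : _ = regs u w (x :: s) (x :: k) l f a b c d e) //.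
by rewrite IH // rev_cons !cat_rcons.
Qed.

(** The tuple is copied to the stack. The record with the opposite verdict is then searched in the
    list, a hit being a contradiction; after that the verdict on top is replaced and the record
    itself joins the list. *)
Definition read_relation v : prog :=
  Seq (pop 0) (Seq (move_while is_bit 3 8) (Seq (loop3 copy_step) (Seq (Push 2 (sep v))
  (Seq (move_while predT 3 6) (Seq (Push 6 (verdict (~~ v)))
  (Seq (loop3 conflict_step) (Seq (loop3 return_step)
  (Seq (pop 6) (Seq (Push 6 (verdict v)) (move_while predT 6 4)))))))))).

Lemma size_encL L : size L <= size (encL L).
Proof.
elim: L => //= p L IH; rewrite /encL /= -/(encL L) size_cat size_rcons.
by rewrite addSn ltnS; apply: leq_trans IH (leq_addl _ _).
Qed.

Lemma size_encL_rev L : size (encL (rev L)) = size (encL L).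
Proof.
elim: L => // p L IH; rewrite rev_cons -cats1 /encL map_cat flatten_cat -/(encL _) size_cat IH.
by rewrite /= cats0 size_cat addnC.
Qed.

Lemma den_read_relation U w S R X L F v : size (key R X) < 3 * n -> size (encL L) <= 3 * n ->
  den n (read_relation v) (regs (map inr U) w (encS S) (key R X) (encL L) (nseq F mark)
    [::] [::] [::] [::] [::]) =
  regs (map inr (behead U)) w (encS ((R, v) :: S)) [::] (encL ((v, (R, X)) :: L))
    (nseq (F + count_mem (~~ v, (R, X)) L) mark) [::] [::] [::] [::] [::].
Proof.
move=> kn Ln; rewrite /read_relation den_seq den_pop /= behead_map.
have szk : size (ents R) <= size (key R X) by rewrite size_cat leq_addr.
rewrite den_seq (@den_move_while _ _ 3 8 (ents R) (map (fun b => inl (LBit b)) X)) //=; last first.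
- lia.
- by case: (X).
- exact: ents_bits.
rewrite cats0 den_seq den_loop3 -/(regs _ _ _ _ _ _ _ _ _ _ _) iter_copy_step ?size_rev; last exact: leq_trans szk (ltnW kn).
rewrite revK -/(key R X) den_seq den_push /=.
rewrite -[sep v :: _]/(encS ((R, v) :: S)).
rewrite den_seq (@den_move_all 3 6 (key R X)) //=; last lia.
rewrite cats0 den_seq den_push /=.
rewrite -[verdict (~~ v) :: _]/(verdict (~~ v, (R, X)).1 :: _) -(rev_record (~~ v, (R, X))).
rewrite den_seq den_loop3 -/(regs _ _ _ _ _ _ _ _ _ _ _) -[[::] as X in regs _ _ _ _ _ _ _ _ _ _ X]/(encL [::]).
rewrite iter_conflict_step //; last first.
- by rewrite size_rcons.
- by apply: leq_trans (size_encL L) Ln.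
rewrite cats0 den_seq den_loop3 -[[::] as X in regs _ _ _ _ X]/(encL [::]).
rewrite iter_return_step ?size_rev ?size_encL_rev //; last first.
  by apply: leq_trans (size_encL L) Ln.
rewrite revK cats0 rev_record den_seq den_pop /= den_seq den_push /=.
rewrite (@den_move_all 6 4 (verdict v :: rev (key R X))) //= ?size_rev //.
by rewrite rev_cons revK.
Qed.


(** * The checker on abstract states *)

Record astate := AState {
  cert : seq bool;
  todo : seq letter;
  stack : seq (seq nat * bool);
  args : seq nat;
  label : seq bool;
  atoms : seq (bool * (seq nat * seq bool));
  faults : nat
}.

Definition sto (a : astate) : store symb :=
  regs (map inr (cert a)) (map inl (todo a)) (encS (stack a)) (key (args a) (label a))
    (encL (atoms a)) (nseq (faults a) mark) [::] [::] [::] [::] [::].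

(** A nonempty register 3 means that ticks or bits have been read whose [LRel] has not been met yet,
    so any operator is out of place. *)
Definition if_free (c : prog) : prog :=
  Case 3 (fun o : option symb => if o is Some _ then fail else c).

Definition on_value (c : bool -> prog) : prog :=
  if_free (Case 2 (fun o : option symb =>
    if o is Some (inl (LBit v)) then Seq (pop 2) (c v) else fail)).

Definition on_tuple (c : prog) : prog := on_value (fun v => Seq c (Push 2 (sep v))).

(** From right to left a relation symbol shows its name, then its ticks, each of which fetches one
    entry from the certificate, and finally [LRel], which fetches the truth value. A bit after a
    tick is therefore a fault. *)
Definition letter_prog (l : letter) : prog :=
  match l with
  | LBit b => Case 3 (fun o : option symb =>
      if o is Some (inr _) then fail else Push 3 (inl (LBit b)))
  | LTick => move_entry 0 3
  | LRel => Case 0 (fun o : option symb => read_relation (o == Some (inr true)))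
  | LE => if_free read_equality
  | LP => on_tuple rotate
  | LS => on_tuple swap
  | LI => on_tuple merge
  | LNeg => on_value (fun v => Push 2 (sep (~~ v)))
  | LJ => on_value join
  end.

Definition check_step : prog :=
  Case 1 (fun o : option symb => if o is Some (inl l) then Seq (pop 1) (letter_prog l) else skip).

Definition is_free (r : seq nat) (x : seq bool) := nilp r && nilp x.

Definition astep_letter (l : letter) (a : astate) : astate :=
  let: AState u w s r x k f := a in
  let err := AState u w s r x k f.+1 in
  let top g h bad := if is_free r x then
      if s is (t, v) :: s' then AState u w ((g t, h v) :: s') r x k (bad t + f) else err
    else err in
  match l with
  | LBit b => if nilp r then AState u w s r (b :: x) k f else err
  | LTick => AState (read_rest u) w s (read_val u :: r) x k f
  | LRel => let v := ohead u == Some true in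
      AState (behead u) w ((r, v) :: s) [::] [::] ((v, (r, x)) :: k)
        (f + count_mem (~~ v, (r, x)) k)
  | LE => if is_free r x then
        let i := read_val u in let j := read_val (read_rest u) in
        AState (read_rest (read_rest u)) w (([:: j; i], i == j) :: s) r x k f
      else err
  | LP => top (rot 1) id xpred0
  | LS => top (@swap_top nat) id xpred0
  | LI => top (@merge_top nat) id differ_top
  | LNeg => top id negb xpred0
  | LJ => if is_free r x then
        match s with
        | (t, v) :: (t', v') :: s' => AState u w ((t' ++ t, v && v') :: s') r x k f
        | _ => err
        end
      else err
  end.

Definition astep (a : astate) : astate :=
  let: AState u w s r x k f := a in
  if w is l :: w' then astep_letter l (AState u w' s r x k f) else a.

(** Two potentials that no step raises beyond the bound. The factor 3 is dictated by [LE], which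
    adds two terminators and a separator to the stack; the ones of its entries are paid for by the
    certificate, but an unterminated entry shows that terminators may not be. There are two
    inequalities because [LRel] copies the arguments both to the stack and to the list. *)
Definition fits (a : astate) : Prop :=
  3 * size (todo a) + size (cert a) + size (encS (stack a)) + size (ents (args a)) <= 3 * n /\
  3 * size (todo a) + size (cert a) + size (key (args a) (label a)) + size (encL (atoms a))
    <= 3 * n.

Lemma size_ents r : size (ents r) = sumn r + size r.
Proof. by elim: r => //= i r IH; rewrite ents_cons size_cat size_ent IH; lia. Qed.

Lemma size_encS_cons r v S : size (encS ((r, v) :: S)) = (size (ents r) + size (encS S)).+1.
Proof. by rewrite /encS /= size_cat. Qed.

Lemma size_encL_cons v r x L :
  size (encL ((v, (r, x)) :: L)) = (size (key r x) + size (encL L)).+1.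
Proof. by rewrite /encL /= size_cat size_rcons. Qed.

Lemma size_key r x : size (key r x) = size (ents r) + size x.
Proof. by rewrite size_cat size_map. Qed.

Lemma fitsE u w s r x k f : fits (AState u w s r x k f) =
  (3 * size w + size u + size (encS s) + size (ents r) <= 3 * n /\
   3 * size w + size u + size (key r x) + size (encL k) <= 3 * n).
Proof. by []. Qed.

Lemma fits_astep a : fits a -> fits (astep a).
Proof.
case: a => u [|l w] s r x k f //; rewrite fitsE [size (l :: w)]/= => -[le1 le2].
have U1 := size_read u; have U2 := size_read (read_rest u).
have key0 : is_free r x -> r = [::] /\ x = [::] by case: r {le1 le2}; case: x.
have err : fits (AState u w s r x k f.+1) by rewrite fitsE; lia.
have top g h bad : (forall t, size (ents (g t)) <= size (ents t)) ->
    fits (if is_free r x then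
      if s is (t, v) :: s' then AState u w ((g t, h v) :: s') r x k (bad t + f)
      else AState u w s r x k f.+1 else AState u w s r x k f.+1).
  move=> gP; case: ifP => // _; case: s le1 err => [|[t v] s] // le1 _.
  by rewrite size_encS_cons in le1; rewrite fitsE size_encS_cons; have := gP t; lia.
case: l => [||b||||||]; rewrite /astep /astep_letter.
- rewrite fitsE size_encS_cons size_encL_cons size_behead !size_key in le2 *.
  by rewrite [size (ents [::])]/= [size [::]]/=; lia.
- by rewrite size_key in le2; rewrite fitsE size_key ents_cons size_cat size_ent; lia.
- case: ifP => // _.
  by rewrite size_key in le2; rewrite fitsE size_key [size (b :: x)]/=; lia.
- case: ifP => // /key0[r0 x0].
  have E i j : size (ents [:: j; i]) = (j + i).+2 by rewrite size_ents /=; lia.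
  by rewrite fitsE size_encS_cons E; lia.
- apply: top => t; rewrite !size_ents size_rot.
  suff -> : sumn (rot 1 t) = sumn t by [].
  by case: t => // a t; rewrite rot1_cons sumn_rcons /= addnC.
- by apply: top => -[|a [|b t]] //; rewrite !size_ents /=; lia.
- by apply: top => -[|a [|b t]] //; rewrite !size_ents /=; lia.
- exact: top.
- case: ifP => // _; case: s le1 err {top} => [|[t v] [|[t' v'] s]] // le1 _.
  by rewrite !size_encS_cons in le1; rewrite fitsE size_encS_cons ents_cat size_cat; lia.
Qed.

Lemma den_if_free u w S r x k f c :
  den n (if_free c) (regs u w (encS S) (key r x) k (nseq f mark) [::] [::] [::] [::] [::]) =
  if is_free r x then
    den n c (regs u w (encS S) (key r x) k (nseq f mark) [::] [::] [::] [::] [::])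
  else regs u w (encS S) (key r x) k (nseq f.+1 mark) [::] [::] [::] [::] [::].
Proof. by rewrite /if_free den_case; case: r => [|[|i] r]; case: x. Qed.

Lemma den_on_value u w S r x k f c :
  den n (on_value c) (regs u w (encS S) (key r x) k (nseq f mark) [::] [::] [::] [::] [::]) =
  if is_free r x then
    if S is (t, v) :: S' then
      den n (c v) (regs u w (ents t ++ encS S') (key r x) k (nseq f mark) [::] [::] [::] [::] [::])
    else regs u w (encS S) (key r x) k (nseq f.+1 mark) [::] [::] [::] [::] [::]
  else regs u w (encS S) (key r x) k (nseq f.+1 mark) [::] [::] [::] [::] [::].
Proof. by rewrite /on_value den_if_free den_case; case: S => [|[t v] S]. Qed.

Lemma den_check_step a : fits a -> den n check_step (sto a) = sto (astep a).
Proof.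
case: a => u [|l w] s r x k f //; rewrite fitsE [size (l :: w)]/= => -[le1 le2].
rewrite /astep.
rewrite /check_step den_case /= den_seq den_pop /= -/(regs _ _ _ _ _ _ _ _ _ _ _).
have top g h bad c : (forall v t S' u w f, size (ents t) <= 3 * n ->
      den n (c v) (regs u w (ents t ++ encS S') (key r x) (encL k) (nseq f mark)
        [::] [::] [::] [::] [::]) =
      regs u w (encS ((g t, h v) :: S')) (key r x) (encL k) (nseq (bad t + f) mark)
        [::] [::] [::] [::] [::]) ->
    den n (on_value c) (regs (map inr u) (map inl w) (encS s) (key r x) (encL k) (nseq f mark)
        [::] [::] [::] [::] [::]) =
    sto (if is_free r x then
      if s is (t, v) :: s' then AState u w ((g t, h v) :: s') r x k (bad t + f)
      else AState u w s r x k f.+1 else AState u w s r x k f.+1).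
  move=> cP; rewrite den_on_value; case: ifP => // _.
  case: s le1 => [|[t v] s] // le1; rewrite cP //.
  by rewrite size_encS_cons in le1; lia.
have tup g bad c : (forall t S' u w f, size (ents t) <= 3 * n ->
      den n c (regs u w (ents t ++ encS S') (key r x) (encL k) (nseq f mark)
        [::] [::] [::] [::] [::]) =
      regs u w (ents (g t) ++ encS S') (key r x) (encL k) (nseq (bad t + f) mark)
        [::] [::] [::] [::] [::]) ->
    den n (on_tuple c) (regs (map inr u) (map inl w) (encS s) (key r x) (encL k) (nseq f mark)
        [::] [::] [::] [::] [::]) =
    sto (if is_free r x then
      if s is (t, v) :: s' then AState u w ((g t, v) :: s') r x k (bad t + f)
      else AState u w s r x k f.+1 else AState u w s r x k f.+1).
  by move=> cP; apply: (top g id bad) => v t S' u' w' f' tn; rewrite den_seq cP.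
case: l => [||b||||||]; rewrite /astep_letter.
- rewrite /letter_prog den_case.
  have -> : (ohead (get (sto (AState u w s r x k f)) 0) == Some (inr true)) =
    (ohead u == Some true) by case: (u) => [|[] ?].
  by rewrite den_read_relation //=; lia.
- rewrite /letter_prog (@den_read_entry _ 0 3 u) //=; last lia.
  by rewrite /sto /= /key ents_cons -catA.
- by rewrite /letter_prog den_case; case: (r) => [|[|i] r'] //; case: (x).
- rewrite /letter_prog den_if_free; case: ifP => // _.
  by rewrite den_read_equality //; lia.
- by apply: tup => t S' u' w' f' tn; rewrite den_rotate.
- by apply: tup => t S' u' w' f' tn; rewrite den_swap.
- by apply: tup => t S' u' w' f' tn; rewrite den_merge.
- by apply: top.
- rewrite /letter_prog den_on_value; case: ifP => // _.
  case: s le1 {top tup} => [|[t v] s] // le1; rewrite den_join.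
    by case: s {le1} => [|[t' v'] s].
  by rewrite size_encS_cons in le1; lia.
Qed.

(** Moving the letters away reverses the word, ready to be read from its end, and leaves the
    certificate in register 0. As this is also the output register, the rest of the certificate is
    erased before the verdict. *)
Definition checker : prog :=
  Seq (move_while (predC is_bit) 0 1) (Seq (loop3 check_step) (Seq (clear 0)
    (Case 5 (fun o : option symb => if o is Some _ then skip else
      Case 3 (fun o : option symb => if o is Some _ then skip else
        Case 2 (fun o : option symb => if o is Some (inl (LBit true)) then
          Seq (pop 2) (Seq (move_while is_bit 2 8)
            (Case 2 (fun o : option symb => if o is Some _ then skip else Push 0 mark)))
          else skip)))))).

Definition accepts (a : astate) : bool :=
  [&& faults a == 0, is_free (args a) (label a) & if stack a is [:: (_, v)] then v else false].

Lemma fits_iter m a : fits a -> fits (iter m astep a).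
Proof. by move=> fa; elim: m => //= m; apply: fits_astep. Qed.

Lemma den_check_loop m a : fits a -> iter m (den n check_step) (sto a) = sto (iter m astep a).
Proof. by move=> fa; elim: m => //= m ->; rewrite den_check_step //; apply: fits_iter. Qed.

Lemma den_checker (w : seq letter) (u : seq bool) : n = size w + size u ->
  (get (den n checker ((map inl w ++ map inr u) :: nseq 10 [::])) 0 != [::]) =
  accepts (iter (3 * n) astep (AState u (rev w) [::] [::] [::] [::] 0)).
Proof.
move=> nE; rewrite /checker den_seq (@den_move_while _ _ 0 1 (map inl w) (map inr u)) //=; last first.
- by rewrite size_map; lia.
- by case: (u).
- by apply/allP => a /mapP[l _ ->].
rewrite cats0 -map_rev; set a0 := AState _ _ _ _ _ _ _.
rewrite -[[:: _; _; _; _; _; _; _; _; _; _; _]]/(sto a0).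
have fit0 : fits a0 by rewrite /fits /= size_rev; split; rewrite /= ?addn0; lia.
rewrite den_seq den_loop3 den_check_loop //.
have := fits_iter (3 * n) fit0; case: (iter _ _ _) => u' W s r x k f [/= le1 le2].
rewrite den_seq den_clear //=; last by rewrite size_map; lia.
rewrite den_case /accepts /=; case: f => [|f] //.
rewrite den_case; case: r le1 le2 => [|[|i] r] le1 le2 //; case: x le2 => [|b x] le2 //.
rewrite den_case /=; case: s le1 => [|[t [|]] s] le1 //; last by case: s {le1}.
rewrite size_encS_cons in le1.
rewrite /= den_seq den_pop /= den_seq.
rewrite (@den_move_while _ _ 2 8 (ents t) (encS s)) //=; last first.
- lia.
- exact: encS_stops.
- exact: ents_bits.
by rewrite den_case; case: s {le1} => [|[t' v'] s].
Qed.

End Operations.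


(** * Correctness of the checker *)

Section Holds.
Context (D : Type).
Implicit Types (q : adrel D) (r : seq D).

(* The tuple is given in reverse. *)
Definition holds q r (v : bool) : Prop :=
  arity q = size r /\ (ad_mem q (rev r) <-> v).

(** On reversed tuples [p] is a rotation by one. Rotation, and likewise [swap_top] and [merge_top],
    fixes lists with at most one entry, in accordance with the convention for small arities. *)
Lemma holds_p q r v : holds q r v -> holds (ad_p q) (rot 1 r) v.
Proof.
case=> ar mem; rewrite /ad_p; case: ifP => [ar2|/negbT].
  split; first by rewrite size_rot.
  rewrite -mem; rewrite ar in ar2; case: r ar mem ar2 => [|a r] //= ar _ ar2.
  rewrite rot1_cons rev_rcons ad_mem_set /= size_rev rev_cons.
  split=> [[_ [v' [a' [[-> ->]]]]] //|m]; split; first by rewrite ar.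
  by exists (rev r), a.
by rewrite ar; case: r ar mem => [|a [|b r]].
Qed.

Lemma holds_s q r v : holds q r v -> holds (ad_s q) (swap_top r) v.
Proof.
case=> ar mem; rewrite /ad_s; case: ifP => [ar2|/negbT].
  rewrite ar in ar2; case: r ar mem ar2 => [|a [|b r]] //= ar mem _; split=> //.
  rewrite -mem !rev_cons -!cats1 -!catA /= ad_mem_set size_cat size_rev /=.
  split=> [[_ [v' [a' [b' [E m]]]]]|m]; last first.
    by split; [rewrite ar /= addn2|exists (rev r), b, a].
  suff [-> [-> ->]] : rev r = v' /\ (b = a' /\ a = b') by [].
  move/(congr1 rev): E; rewrite !rev_cat revK => -[-> -> /(congr1 rev)].
  by rewrite !revK.
by rewrite ar; case: r ar mem => [|a [|b r]].
Qed.

(** A tuple whose last two entries differ says nothing about [I]; this is why the checker counts it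
    as a fault. *)
Lemma holds_I q r v : (if r is a :: b :: _ then a = b else True) ->
  holds q r v -> holds (ad_I q) (merge_top r) v.
Proof.
move=> top [ar mem]; rewrite /ad_I; case: ifP => [ar2|/negbT].
  rewrite ar in ar2; case: r top ar mem ar2 => [|a [|b r]] //= <- ar mem _.
  split; first by rewrite ar.
  rewrite -mem !rev_cons -!cats1 -!catA /= ad_mem_set size_cat size_rev /=.
  split=> [[_ [v' [a' [E m]]]]|m]; last first.
    by split; [rewrite ar /= addn1|exists (rev r), a; rewrite cats1].
  suff [-> ->] : rev r = v' /\ a = a' by [].
  by move: E; rewrite cats1 => /rcons_inj[].
by rewrite ar; case: r top ar mem => [|a [|b r]].
Qed.

Lemma holds_neg q r v : holds q r v -> holds (ad_neg q) r (~~ v).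
Proof.
case=> ar mem; split=> //; rewrite ad_mem_neg ?size_rev // mem.
by split=> [/negP|/negP].
Qed.

Lemma holds_J q q' r r' v v' : holds q r v -> holds q' r' v' ->
  holds (ad_J q q') (r' ++ r) (v && v').
Proof.
move=> [ar mem] [ar' mem']; split; first by rewrite /= ar ar' size_cat addnC.
rewrite rev_cat ad_mem_J ?size_rev // mem mem'.
by split=> [[-> ->]|/andP].
Qed.

Lemma holds_e a b (v : bool) : (v <-> a = b) -> holds (ad_e D) [:: b; a] v.
Proof.
move=> vP; split=> //; rewrite /ad_e ad_mem_set vP; split=> [[_ [c [-> ->]]]|->] //.
by split=> //; exists b.
Qed.

End Holds.

Lemma ad_mem_Rel (A : model) k x s (ks : size s == k) :
  ad_mem (interp A (Rel k x)) s <-> @rel_interp A k x (Tuple ks).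
Proof.
split=> [[t ts]|] /=; last by exists (Tuple ks).
by have -> : t = Tuple ks by apply/val_inj.
Qed.

(** ** Soundness *)

Definition consistent (L : seq (bool * (seq nat * seq bool))) : Prop :=
  forall v p, (v, p) \in L -> (~~ v, p) \notin L.

Lemma faults_astep a : faults a <= faults (astep a).
Proof.
case: a => u [|l w] s r x k f //.
case: l => [||b||||||]; rewrite /astep /astep_letter;
  case: (is_free _ _); case: (nilp r); case: s => [|[t v] [|[t' v'] s]] //=; lia.
Qed.

Lemma atoms_astep a : {subset atoms a <= atoms (astep a)}.
Proof.
case: a => u [|l w] s r x k f //.
case: l => [||b||||||]; rewrite /astep /astep_letter;
  case: (is_free _ _); case: (nilp r); case: s => [|[t v] [|[t' v'] s]] //= p pk;
  by rewrite inE pk orbT.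
Qed.

Lemma consistent_astep a :
  consistent (atoms a) -> faults (astep a) = 0 -> consistent (atoms (astep a)).
Proof.
case: a => u [|l w] s r x k f //.
case: l => [||b||||||]; rewrite /astep /astep_letter;
  try by case: (is_free _ _); case: (nilp r); case: s => [|[t v] [|[t' v'] s]].
move=> /= cons; set v := _ == _ => /eqP; rewrite addn_eq0 => /andP[_].
(* Absence of faults means that the opposite of the new record does not occur in the old list. *)
rewrite -leqn0 leqNgt -has_count has_pred1 => new v' p; rewrite !inE.
case/predU1P=> [[-> ->]|pk].
  by rewrite negb_or new andbT xpair_eqE; case: (v).
rewrite negb_or (cons _ _ pk) andbT; apply: contraNneq new => -[<- <-].
by rewrite negbK.
Qed.

Section Soundness.
Context (L : seq (bool * (seq nat * seq bool))) (Lcons : consistent L).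

(** The numbers in the certificate become the elements, and exactly the atoms recorded as true hold;
    consistency then makes those recorded as false fail. *)
Definition log_model : model :=
  @Model nat (inhabits 0) (fun k x t => (true, (rev (val t), x)) \in L).

Fixpoint matches (Ts : seq term) (s : seq (seq nat * bool)) : Prop :=
  match Ts, s with
  | [::], [::] => True
  | T :: Ts, (r, v) :: s => holds (interp log_model T) r v /\ matches Ts s
  | _, _ => False
  end.

(** The part already read consists of the tail of a relation symbol and of complete terms, one for
    each tuple on the stack. *)
Definition parsed (a : astate) (w : seq letter) : Prop :=
  exists2 Ts, w = nseq (size (args a)) LTick ++ map LBit (label a) ++ flatten (map encode Ts) &
    matches Ts (stack a).

Lemma holds_Rel r x v : (v, (r, x)) \in L -> holds (interp log_model (Rel (size r) x)) r v.
Proof.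
move=> rL; split=> //.
have sr : size (rev r) == size r by rewrite size_rev.
rewrite (@ad_mem_Rel log_model _ x (rev r) sr) /= revK; split=> [tL|vt]; last by rewrite vt in rL.
by case: v rL => // /Lcons; rewrite tL.
Qed.

Lemma is_freeP r x : is_free r x -> r = [::] /\ x = [::].
Proof. by case: r; case: x. Qed.

(** The model is built from the final list [L], so values assigned at any stage are already correct
    in it, provided that the current list is contained in [L]. *)
Lemma parsed_astep u l w s r x k f v :
  let a := AState u (l :: w) s r x k f in
  parsed a v -> faults (astep a) = 0 -> {subset atoms (astep a) <= L} ->
  parsed (astep a) (l :: v).
Proof.
move=> a; rewrite {}/a /astep /astep_letter => -[Ts vE m]; rewrite /= in vE m.
have top g h (bad : seq nat -> bool) c lt : (forall T, encode (c T) = lt :: encode T) ->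
    (forall t b T, bad t = false -> holds (interp log_model T) t b ->
       holds (interp log_model (c T)) (g t) (h b)) ->
    let a' := if is_free r x then
      if s is (t, v) :: s' then AState u w ((g t, h v) :: s') r x k (bad t + f)
      else AState u w s r x k f.+1 else AState u w s r x k f.+1 in
    faults a' = 0 -> parsed a' (lt :: v).
  move=> cE cP /=; case: ifP => // /is_freeP[r0 x0].
  case: s m => [|[t b] s] // m /= bf; rewrite /parsed /= vE r0 x0 /=.
  case: Ts {vE} m => [|T Ts] // [hT m]; exists (c T :: Ts); first by rewrite /= cE.
  by split=> //; apply: cP hT; case: (bad t) bf.
case: l => [||b||||||].
- move=> /= _ sub; exists (Rel (size r) x :: Ts); first by rewrite /= vE -!catA.
  by split=> //; apply: holds_Rel; apply: sub; rewrite inE eqxx.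
- by move=> _ _; exists Ts => //=; rewrite vE.
- case: ifP => // /nilP r0 _ _; exists Ts => //=.
  by rewrite vE r0.
- case: ifP => // /is_freeP[r0 x0] _ _; exists (TermE :: Ts).
    by rewrite /= vE r0 x0.
  by split=> //; apply: holds_e; rewrite eq_sym; split=> [/eqP|->].
- by move=> f0 _; apply: (top (rot 1) id xpred0 TermP) f0 => // t b T _; apply: holds_p.
- by move=> f0 _; apply: (top (@swap_top nat) id xpred0 TermS) f0 => // t b T _; apply: holds_s.
- move=> f0 _; apply: (top (@merge_top nat) id differ_top TermI) f0 => // t b T d.
  by apply: holds_I; case: t d => [|i [|j t]] //= /eqP.
- by move=> f0 _; apply: (top id negb xpred0 TermNeg) f0 => // t b T _; apply: holds_neg.
- case: ifP => // /is_freeP[r0 x0]; case: s m {top} => [|[t b] [|[t' b'] s]] //= m _ _.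
  case: Ts vE m => [|T [|T' Ts]] vE; [by []|by case|].
  case=> hT [hT' m]; exists (TermJ T T' :: Ts); first by rewrite /= vE r0 x0 /= catA.
  by split=> //; apply: holds_J.
Qed.

End Soundness.

Lemma iter_faults m a : faults a <= faults (iter m astep a).
Proof. by elim: m => //= m IH; apply: leq_trans IH (faults_astep _). Qed.

Lemma iter_atoms m a : {subset atoms a <= atoms (iter m astep a)}.
Proof. by elim: m => //= m IH p /IH; apply: atoms_astep. Qed.

(** Faults only accumulate, so acceptance after [N] steps excludes them at every earlier step, and
    [parsed] holds throughout. By then the whole word has been read, and the single tuple on the
    stack satisfies the term. *)
Lemma accepts_sound w u N : size w <= N ->
  accepts (iter N astep (AState u (rev w) [::] [::] [::] [::] 0)) -> GRA_sat w.
Proof.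
set a0 := AState _ _ _ _ _ _ _ => wN acc.
have f0 m : m <= N -> faults (iter m astep a0) = 0.
  move=> mN; apply/eqP; rewrite -leqn0; case/and3P: acc => /eqP <- _ _.
  by rewrite -(subnK mN) iterD iter_faults.
have Lcons : consistent (atoms (iter N astep a0)).
  have : forall m, m <= N -> consistent (atoms (iter m astep a0)).
    elim=> // m IH mN; apply: consistent_astep; first exact/IH/ltnW.
    exact: f0 mN.
  exact.
have P m : m <= N -> exists2 v, rev (todo (iter m astep a0)) ++ v = w &
    size (todo (iter m astep a0)) = size w - m /\
    parsed (atoms (iter N astep a0)) (iter m astep a0) v.
  elim: m => [|m IH] mN; first by exists [::]; rewrite ?cats0 ?revK ?subn0 ?size_rev //; split=> //; exists [::].
  have [v vE [sz pv]] := IH (ltnW mN).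
  have := f0 _ mN; have : {subset atoms (iter m.+1 astep a0) <= atoms (iter N astep a0)}.
    by move=> p pm; rewrite -(subnK mN) iterD; apply: iter_atoms.
  rewrite iterS; case: (iter m astep a0) vE sz pv => u' [|l w'] s r x k f vE sz pv sub f1.
    by exists v => //; split=> //; rewrite /= in sz *; rewrite subnS -sz.
  have -> : todo (astep (AState u' (l :: w') s r x k f)) = w'.
    rewrite /astep /astep_letter; case: (l) => [||?||||||]; case: (is_free _ _);
    case: (nilp r); by case: (s) => [|[? ?] [|[? ?] ?]].
  exists (l :: v); first by rewrite -vE /= rev_cons cat_rcons.
  by split; [rewrite /= in sz; rewrite subnS -sz|apply: parsed_astep].
have [v vE [sz [Ts vT m]]] := P N (leqnn N).
move: m {Lcons P f0}; set K := atoms _; move: K => K.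
move: acc vE sz vT; case: (iter N astep a0) => u' w' s r x k f.
rewrite /accepts /= => /and3P[_ /is_freeP[-> ->]] st vE.
have -> : size w - N = 0 by apply/eqP.
move/size0nil => w0; rewrite w0 /= in vE; rewrite vE => wT.
case: s st => [|[t [|]] [|]] //= _; case: Ts wT => [|T [|T' Ts]] // wT.
  case=> hT _; exists T; first by rewrite wT /= cats0.
  by exists (log_model K), (rev t); apply/hT.2.
by case.
Qed.

(** ** Completeness *)

Lemma read_code i u : read_val (nseq i true ++ false :: u) = i /\
  read_rest (nseq i true ++ false :: u) = u.
Proof.
have E : index false (nseq i true ++ false :: u) = i.
  by elim: i => //= i ->.
rewrite /read_rest /read_val E; split=> //.
by rewrite -cat_rcons drop_size_cat // size_rcons size_nseq.
Qed.

Definition code (r : seq nat) : seq bool := flatten [seq rcons (nseq i true) false | i <- r].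

Lemma code_cons i r u : code (i :: r) ++ u = nseq i true ++ false :: code r ++ u.
Proof. by rewrite /code /= -catA cat_rcons. Qed.

Lemma size_code r m : all (fun i => i < m) r -> size (code r) <= size r * m.
Proof.
elim: r => //= i r IH /andP[im /IH le].
by rewrite /code /= size_cat size_rcons size_nseq mulSn leq_add.
Qed.

Lemma iter_bits U W S X L F x :
  iter (size x) astep (AState U (rev (map LBit x) ++ W) S [::] X L F) =
  AState U W S [::] (x ++ X) L F.
Proof.
elim/last_ind: x X => // x b IH X.
by rewrite size_rcons iterSr map_rcons rev_rcons /= IH cat_rcons.
Qed.

(** Each entry read is put in front of the earlier ones, so the certificate lists them in
    reverse. *)
Lemma iter_ticks U W S R X L F r :
  iter (size r) astep (AState (code (rev r) ++ U) (nseq (size r) LTick ++ W) S R X L F) =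
  AState U W S (r ++ R) X L F.
Proof.
elim/last_ind: r R => // r i IH R.
rewrite size_rcons iterSr rev_rcons code_cons cat_rcons -IH; congr iter.
by rewrite /= (read_code i _).1 (read_code i _).2.
Qed.

Section Completeness.
Context (A : model) (g : nat -> dom A) (m : nat).
Context (g_inj : forall i j, i < m -> j < m -> g i = g j -> i = j).

Definition truthful (L : seq (bool * (seq nat * seq bool))) : Prop :=
  forall v r x, (v, (r, x)) \in L -> holds (interp A (Rel (size r) x)) (map g r) v.

Lemma holds_ex (q : adrel (dom A)) (r : seq (dom A)) : arity q = size r -> exists v, holds q r v.
Proof.
by move=> ar; case: (classic (ad_mem q (rev r))) => H; [exists true|exists false].
Qed.

Lemma holds_inj (q : adrel (dom A)) r v v' : holds q r v -> holds q r v' -> v = v'.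
Proof. by case=> _ -[qv vq] [_ [qv' vq']]; apply/idP/idP; tauto. Qed.

Lemma swap_topK T : involutive (@swap_top T).
Proof. by case=> [|a [|b r]]. Qed.

Lemma map_swap_top T T' (h : T -> T') r : map h (swap_top r) = swap_top (map h r).
Proof. by case: r => [|a [|b r]]. Qed.

(** The tuple is handed down from the root by inverting each operator, which introduces no new
    entries, and the leaves write it into the certificate with their true values in [A]. In the size
    bound the factor 2 comes from [e], which needs two entries for a single letter. Arbitrary [U],
    [W] and [S] let the runs of both arguments of [J] be chained. *)
Lemma run_encode T r : size r = arity (interp A T) -> all (fun i => i < m) r ->
  exists v c, [/\ holds (interp A T) (map g r) v,
    size c <= 2 * m.+1 * size (encode T) &
    forall U W S L, truthful L -> exists2 L', truthful L' &
      iter (size (encode T)) astep (AState (c ++ U) (rev (encode T) ++ W) S [::] [::] L 0) =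
      AState U W ((r, v) :: S) [::] [::] L' 0].
Proof.
elim: T r => [k x||T IH|T IH|T IH|T IH|T1 IH1 T2 IH2] r ar rm.
- have {}ar : size r = k := ar; subst k.
  have [v vP] : exists v, holds (interp A (Rel (size r) x)) (map g r) v.
    by apply: holds_ex; rewrite size_map.
  exists v, (code (rev r) ++ [:: v]); split=> //.
    rewrite size_cat /= size_cat size_nseq size_map.
    by have := @size_code (rev r) m; rewrite all_rev size_rev /= => /(_ rm); nia.
  move=> U W S L Lt; exists ((v, (r, x)) :: L).
    by move=> v' r' x'; rewrite inE => /predU1P[[-> -> ->]|]; last exact: Lt.
  have -> : rev (encode (Rel (size r) x)) ++ W =
      rev (map LBit x) ++ nseq (size r) LTick ++ LRel :: W.
    by rewrite /= rev_cons rev_cat rev_nseq cat_rcons -catA.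
  have -> : size (encode (Rel (size r) x)) = 1 + (size r + size x).
    by rewrite /= size_cat size_nseq size_map.
  rewrite iterD iterD iter_bits -catA iter_ticks !cats0 /=.
  have -> : (Some v == Some true) = v by case: (v).
  (* The list is truthful, so it cannot contain the opposite of a value taken in [A]. *)
  have -> // : count_mem (~~ v, (r, x)) L = 0.
  apply/count_memPn; apply/negP => /Lt /(holds_inj vP).
  by case: (v).
- case: r ar rm => [|j [|i [|? ?]]] // _ /and3P[jm im _].
  have vP : holds (ad_e (dom A)) (map g [:: j; i]) (i == j).
    by apply: holds_e; split=> [/eqP->|/g_inj->].
  exists (i == j), (code [:: i; j]); split=> //.
    have := @size_code [:: i; j] m; rewrite /= im jm => /(_ isT); lia.
  move=> U W S L Lt; exists L => //.
  by rewrite /= code_cons !(read_code _ _).1 !(read_code _ _).2 code_cons !(read_code _ _).1 !(read_code _ _).2.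
- have [||v [c [vP cn run]]] := IH (rotr 1 r).
  + by rewrite size_rotr ar /= /ad_p; case: ifP.
  + by apply/allP => i; rewrite mem_rotr; apply: (allP rm).
  exists v, c; split.
  + by rewrite -[r](rotrK 1) map_rot; apply: holds_p.
  + by rewrite /=; nia.
  move=> U W S L Lt; have [L' L't E] := run U (LP :: W) S L Lt; exists L' => //.
  by rewrite iterS rev_cons cat_rcons E /= rotrK.
- have [||v [c [vP cn run]]] := IH (swap_top r).
  + rewrite (_ : size (swap_top r) = size r); last by case: (r) => [|? [|? ?]].
    by rewrite ar /= /ad_s; case: ifP.
  + by case: (r) rm => [|? [|? ?]] //= /and3P[-> -> ->].
  exists v, c; split.
  + by rewrite -[r]swap_topK map_swap_top; apply: holds_s.
  + by rewrite /=; nia.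
  move=> U W S L Lt; have [L' L't E] := run U (LS :: W) S L Lt; exists L' => //.
  by rewrite iterS rev_cons cat_rcons E /= swap_topK.
(* Going down through [I] doubles the last entry, which is the head of the reversed tuple. *)
- pose r' := if 2 <= arity (interp A T) then (if r is a :: _ then a :: r else r) else r.
  have mr : merge_top r' = r.
    move: ar; rewrite /r' /= /ad_I; case: ifP => [|/negbT]; first by case: (r).
    by rewrite -leqNgt => + ar; rewrite -ar; case: (r) => [|? [|? ?]].
  have dr : differ_top r' = false.
    move: ar; rewrite /r' /= /ad_I; case: ifP => [|/negbT].
      by case: (r) => //= a l _; rewrite eqxx.
    by rewrite -leqNgt => + ar; rewrite -ar; case: (r) => [|? [|? ?]].
  have [||v [c [vP cn run]]] := IH r'.
  + move: ar; rewrite /r' /= /ad_I; case: ifP => // ar2 /=.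
    by case: (r) => [|a l] /= E; lia.
  + by rewrite /r'; case: ifP => // _; case: (r) rm => //= a l /andP[-> ->].
  exists v, c; split.
  + have -> : map g r = merge_top (map g r').
      by rewrite -{1}mr; case: (r') => [|? [|? ?]].
    by apply: holds_I => //; case: (r') dr => [|a [|b l]] //= /negbFE/eqP->.
  + by rewrite /=; nia.
  move=> U W S L Lt; have [L' L't E] := run U (LI :: W) S L Lt; exists L' => //.
  by rewrite iterS rev_cons cat_rcons E /= mr dr.
- have [||v [c [vP cn run]]] := IH r => //.
  exists (~~ v), c; split; first exact: holds_neg.
  + by rewrite /=; nia.
  move=> U W S L Lt; have [L' L't E] := run U (LNeg :: W) S L Lt; exists L' => //.
  by rewrite iterS rev_cons cat_rcons E.
(* In the reversed tuple the entries of the right argument come before those of the left one; the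
   right argument is also read first, so its certificate precedes. *)
- pose k := arity (interp A T2).
  have sr : size r = arity (interp A T1) + k by [].
  have [||v1 [c1 [vP1 cn1 run1]]] := IH1 (drop k r).
  + by rewrite size_drop; lia.
  + by move: rm; rewrite -{1}(cat_take_drop k r) all_cat => /andP[].
  have [||v2 [c2 [vP2 cn2 run2]]] := IH2 (take k r).
  + by rewrite size_takel //; lia.
  + by move: rm; rewrite -{1}(cat_take_drop k r) all_cat => /andP[].
  exists (v1 && v2), (c2 ++ c1); split.
  + by rewrite -(cat_take_drop k r) map_cat; apply: holds_J.
  + by rewrite /= !size_cat; nia.
  move=> U W S L Lt.
  have [L2 L2t E2] := run2 (c1 ++ U) (rev (encode T1) ++ LJ :: W) S L Lt.
  have [L1 L1t E1] := run1 U (LJ :: W) ((take k r, v2) :: S) L2 L2t.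
  exists L1 => //.
  have -> : size (encode (TermJ T1 T2)) = (size (encode T1) + size (encode T2)).+1.
    by rewrite /= size_cat.
  have -> : rev (encode (TermJ T1 T2)) ++ W = rev (encode T2) ++ rev (encode T1) ++ LJ :: W.
    by rewrite /= rev_cons rev_cat cat_rcons -catA.
  by rewrite iterS iterD -catA E2 E1 /= cat_take_drop.
Qed.

End Completeness.

Lemma arity_bound A T : arity (interp A T) <= 2 * size (encode T).
Proof.
elim: T => [k x||T IH|T IH|T IH|T IH|T1 IH1 T2 IH2] //=.
- by rewrite size_cat size_nseq; lia.
- by rewrite /ad_p; case: ifP => _ /=; lia.
- by rewrite /ad_s; case: ifP => _ /=; lia.
- by rewrite /ad_I; case: ifP => _ /=; lia.
- by lia.
- by rewrite size_cat; lia.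
Qed.

(** Extracts the equality pattern: [d] lists the distinct entries and [r] rewrites the tuple as
    positions in [d]. Membership is decided classically, since the domain of a model is an arbitrary
    type. *)
Lemma index_seq (D : Type) (x : seq D) (a0 : D) : exists d r,
  [/\ map (nth a0 d) r = x, all (fun i => i < size d) r, size d <= size x &
      forall i j, i < size d -> j < size d -> nth a0 d i = nth a0 d j -> i = j].
Proof.
elim: x => [|a x [d [r [rx rd dx inj]]]]; first by exists [::], [::].
case: (classic (exists2 i, i < size d & nth a0 d i = a)) => [[i id ia]|new].
  exists d, (i :: r); split=> //=; [by rewrite ia rx|by rewrite id|exact: leqW].
exists (rcons d a), (size d :: r); rewrite size_rcons; split=> //=.
- rewrite nth_rcons ltnn eqxx -rx; congr (_ :: _); apply/eq_in_map => i ir.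
  by rewrite nth_rcons (allP rd _ ir).
- by rewrite leqnn; apply: sub_all rd => i; apply: leqW.
- move=> i j; rewrite !ltnS !nth_rcons.
  case: (ltngtP i (size d)) => // [id|->] _.
    case: (ltngtP j (size d)) => // [jd|->] _; first exact: inj.
    by move=> E; case: new; exists i.
  case: (ltngtP j (size d)) => // jd _ E.
  by case: new; exists j.
Qed.

Lemma accepts_complete T : satisfiable T -> exists2 u : seq bool,
  size u <= poly_bound 10 2 (size (encode T)) &
  forall N, size (encode T) <= N ->
    accepts (iter N astep (AState u (rev (encode T)) [::] [::] [::] [::] 0)).
Proof.
case=> A [x xT]; have [a0] := dom_inhabited A.
have [d [r [rx rd dx inj]]] := index_seq (rev x) a0.
have sr : size r = arity (interp A T).
  by rewrite -(size_map (nth a0 d)) rx size_rev (ad_mem_size xT).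
have [v [c [vP cn run]]] := run_encode inj sr rd.
exists c.
  (* With [n] letters there are at most [2 * n] distinct entries, hence at most
     [2 * (2 * n + 1) * n] bits, which [10 * n ^ 2 + 10] covers generously. *)
  rewrite (leq_trans cn) // /poly_bound; move: (arity_bound A T).
  by rewrite size_rev (ad_mem_size xT) in dx; nia.
move=> N TN; have [//|L' _] := run [::] [::] [::] [::].
rewrite !cats0 -(subnK TN) iterD => ->.
rewrite iter_fix // /accepts /=.
by case: vP => _; rewrite rx revK => -[->].
Qed.

Theorem GRA_sat_in_NP : in_NP GRA_sat.
Proof.
pose V (z : seq (letter + bool)) := get (den (size z) checker (z :: nseq 10 [::])) 0 != [::].
exists V, 10, 2; split.
  have [M [i [b [d [i_inj MP]]]]] := program_machine checker 10.
  exists M, i, b, d; split=> // w; have [H _ acc] := MP w.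
  by split=> //; rewrite acc.
move=> w; split=> [[T -> /accepts_complete[u uT acc]]|[u _]].
  exists u => //; rewrite /V den_checker; last by rewrite size_cat !size_map.
  by apply: acc; rewrite size_cat !size_map; apply: leq_trans (leq_addr _ _) (leq_pmull _ _).
rewrite /V den_checker; last by rewrite size_cat !size_map.
by apply: accepts_sound; rewrite size_cat !size_map; apply: leq_trans (leq_addr _ _) (leq_pmull _ _).
Qed.

Theorem corollary5p3 : NP_complete GRA_sat.
Proof. by split; [exact: GRA_sat_in_NP|exact: GRA_sat_NP_hard]. Qed.
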